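(* Let $(\chi_1,\dots,\chi_k)$ be a collection of characters of $\mathbb F_q^*$ and let $(n_1,\dots,n_k)$ be integers such that $\gcd(n_i,q)=1$. Assume that there are constants $c\in\mathbb C^*$, $a\in\mathbb F_q^*$ such that for any $d\ge1$ and for any character $\lambda\in X(\mathbb F_{q^d}^* )$ such that $\lambda^{-1}\ne\chi_i\circ\mathrm{Nm}_d$ for any $i$, one has $$\prod_{i=1}^k\big(-g(\lambda^{n_i}(\chi_i\circ\mathrm{Nm}_d),\psi\circ\mathrm{Tr}_d)\big)=c^d\cdot\lambda(a).$$ Then $\sum_{i=1}^kD_{\chi_i,n_i}=0$ in $\mathrm{Div}(X)$.
   Context: $\mathbb F_q$ is a finite field and $\psi:\mathbb F_q\to\mathbb C^*$ is a fixed non-trivial additive character. $\mathrm{Nm}_d:\mathbb F_{q^d}^*\to\mathbb F_q^*$ and $\mathrm{Tr}_d:\mathbb F_{q^d}\to\mathbb F_q$ are the norm and the trace. For a character $\mu$ of $\mathbb F_{q^d}^*$, $g(\mu,\psi\circ\mathrm{Tr}_d)=\sum_{x\in\mathbb F_{q^d}^*}\mu(x)\psi(\mathrm{Tr}_d(x))$ (equal to $-1$ for $\mu=1$). $X_d=X(\mathbb F_{q^d}^* )$ is the group of ($\mathbb C^*$-valued) characters of $\mathbb F_{q^d}^*$; for $d_1|d_2$, $X_{d_1}\subset X_{d_2}$ via composition with the norm; $X=\varinjlim_dX_d$. $\mathrm{Div}(X)$ is the free abelian group on the set $X$. For $\chi\in X$ and $n>0$ with $\gcd(n,q)=1$, $D_{\chi,n}=\sum_{\xi\in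 X:\ \xi^n=\chi}(\xi)$, and $D_{\chi^{-1},-n}=-D_{\chi,n}$ (the $n_i$ may be negative). *)

(* Defs.v *)
From HB Require Import structures.
From mathcomp Require Import all_boot all_order all_algebra all_fingroup.
From mathcomp Require Import all_solvable all_field generic_quotient.
From mathcomp Require Import boolp classical_sets functions cardinality fsbigop.
From mathcomp Require Import finmap freeg.

Set Implicit Arguments.
Unset Strict Implicit.
Unset Printing Implicit Defensive.

Import GRing.Theory.
Local Open Scope ring_scope.

(* A multiplicative character of the finite field L, i.e. a homomorphism
   L^* -> C^*, is stored as the function L -> C extending it by 0 at 0. *)
Section MulChar.
Variables (L : finFieldType) (C : fieldType).

Definition is_mulchar (f : {ffun L -> C}) : bool :=
  [&& f 0 == 0, f 1 == 1 & [forall x, forall y, f (x * y) == f x * f y]].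

Record mulchar := MulChar {mulchar_ffun :> {ffun L -> C}; _ : is_mulchar mulchar_ffun}.
HB.instance Definition _ := [isSub for mulchar_ffun].
HB.instance Definition _ := [Choice of mulchar by <:].

Implicit Types (f g h : mulchar) (x y : L).

Lemma mulcharP (f : {ffun L -> C}) :
  reflect [/\ f 0 = 0, f 1 = 1 & {morph f : x y / x * y}] (is_mulchar f).
Proof.
apply: (iffP and3P) => [[/eqP f0 /eqP f1 /'forall_forallP fM]|[-> -> fM]].
  by split=> // x y; apply/eqP.
by split=> //; apply/'forall_forallP=> x y; apply/eqP.
Qed.

Lemma mulchar0 f : f 0 = 0. Proof. by case: f => f /= /mulcharP[]. Qed.
Lemma mulchar1 f : f 1 = 1. Proof. by case: f => f /= /mulcharP[]. Qed.
Lemma mulcharM f : {morph f : x y / x * y}.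
Proof. by case: f => f /= /mulcharP[]. Qed.
Lemma mulchar_inj f g : f =1 g -> f = g.
Proof. by move=> fg; apply/val_inj/ffunP. Qed.
Lemma mulchar_eq0 f x : (f x == 0) = (x == 0).
Proof.
have [->|nz_x] := eqVneq x 0; first by rewrite mulchar0 eqxx.
apply/negbTE/eqP=> fx0; have := mulchar1 f.
by rewrite -(mulfV nz_x) mulcharM fx0 mul0r => /eqP; rewrite eq_sym oner_eq0.
Qed.

Fact mulchar_one_subproof : is_mulchar [ffun x => (x != 0)%:R].
Proof.
apply/mulcharP; split=> [||x y]; rewrite !ffunE ?eqxx ?oner_neq0 //.
by rewrite mulf_eq0 negb_or -natrM mulnb.
Qed.
Definition mulchar_one := MulChar mulchar_one_subproof.

Fact mulchar_mul_subproof f g : is_mulchar [ffun x => f x * g x].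
Proof.
apply/mulcharP; split=> [||x y]; rewrite !ffunE ?mulchar0 ?mulchar1 ?mulr0 ?mulr1 //.
by rewrite !mulcharM mulrACA.
Qed.
Definition mulchar_mul f g := MulChar (mulchar_mul_subproof f g).

Fact mulchar_inv_subproof f : is_mulchar [ffun x => (f x)^-1].
Proof.
apply/mulcharP; split=> [||x y]; rewrite !ffunE ?mulchar0 ?mulchar1 ?invr0 ?invr1 //.
by rewrite mulcharM invfM.
Qed.
Definition mulchar_inv f := MulChar (mulchar_inv_subproof f).

Fact mulchar_mulC : commutative mulchar_mul.
Proof. by move=> f g; apply: mulchar_inj => x; rewrite !ffunE mulrC. Qed.
Fact mulchar_mulA : associative mulchar_mul.
Proof. by move=> f g h; apply: mulchar_inj => x; rewrite !ffunE mulrA. Qed.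
Fact mulchar_mul1 : left_id mulchar_one mulchar_mul.
Proof.
move=> f; apply: mulchar_inj => x; rewrite !ffunE.
by have [->|_] := eqVneq x 0; rewrite ?mulchar0 ?mulr0 ?mul1r.
Qed.
Fact mulchar_mulV : left_inverse mulchar_one mulchar_inv mulchar_mul.
Proof.
move=> f; apply: mulchar_inj => x; rewrite !ffunE.
have [->|nz_x] := eqVneq x 0; first by rewrite mulchar0 mulr0.
by rewrite mulVf // mulchar_eq0.
Qed.

HB.instance Definition _ := isGroup.Build mulchar
  mulchar_mulA mulchar_mul1
  (fun f => etrans (mulchar_mulC _ _) (mulchar_mul1 f))
  mulchar_mulV (fun f => etrans (mulchar_mulC _ _) (mulchar_mulV f)).

Lemma mulcharMgE f g x : (f * g)%g x = f x * g x. Proof. exact: ffunE. Qed.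
Lemma mulchar1gE x : (1%g : mulchar) x = (x != 0)%:R. Proof. exact: ffunE. Qed.
Lemma mulcharVgE f x : (f^-1)%g x = (f x)^-1. Proof. exact: ffunE. Qed.

Definition gauss_sum (mu : mulchar) (psi : L -> C) : C :=
  \sum_(x : L | x != 0) mu x * psi x.

End MulChar.

Section Pullback.
Variables (L M : finFieldType) (C : fieldType) (N : M -> L).
Hypotheses (N0 : N 0 = 0) (N1 : N 1 = 1) (NM : {morph N : x y / x * y}).

Fact pullback_subproof (f : mulchar L C) : is_mulchar [ffun x => f (N x)].
Proof.
apply/mulcharP; split=> [||x y]; rewrite !ffunE ?N0 ?N1 ?mulchar0 ?mulchar1 //.
by rewrite NM mulcharM.
Qed.
Definition pullback (f : mulchar L C) := MulChar (pullback_subproof f).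

Lemma pullbackE f x : pullback f x = f (N x). Proof. exact: ffunE. Qed.
End Pullback.

(* Integer powers in a group; x ^- m is (x ^+ m)^-1. *)
Definition expgz (G : groupType) (x : G) (n : int) : G :=
  match n with Posz m => (x ^+ m)%g | Negz m => (x ^- m.+1)%g end.

Record degree := Degree {deg :> nat; deg_gt0 : (0 < deg)%N}.
HB.instance Definition _ := [isSub for deg].
HB.instance Definition _ := [Countable of degree by <:].

Definition deg1 : degree := Degree (ltnSn 0).
Fact degM_subproof (d e : degree) : (0 < d * e)%N.
Proof. by rewrite muln_gt0 !deg_gt0. Qed.
Definition degM (d e : degree) : degree := Degree (degM_subproof d e).

Section GaloisNorm.
Variables (F : finFieldType) (L : splittingFieldType F) (E : {subfield L}).

Lemma big_Gal_frob (R : Type) (idx : R) (op : Monoid.com_law idx) (h : L -> R) x :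
  \big[op/idx]_(s in 'Gal({:L} / E)%g) h (s x)
    = \big[op/idx]_(i < \dim_E {:L}) h (x ^+ ((#|F| ^ \dim E) ^ i)).
Proof.
have [s /eqP Ds Es] := finField_galois_generator (subvf E).
have Dorder : \dim_E {:L} = #[s]%g.
  by rewrite galois_dim ?finField_galois ?subvf // Ds.
have imE : <[s]>%g = [set (s ^+ i)%g | i : 'I_#[s]%g].
  apply/setP=> y; apply/idP/imsetP=> [/cyclePmin[i lt_i ->]|[i _ ->]].
    by exists (Ordinal lt_i).
  exact: mem_cycle.
rewrite Dorder Ds imE big_imset /=; last first.
  move=> i j _ _ /eqP; rewrite eq_expg_mod_order !modn_small // => /eqP.
  exact: val_inj.
apply: eq_bigr => i _; congr (h _).
elim: (i : nat) => [|m IHm]; first by rewrite gal_id.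
rewrite expgSr galM ?memvf // IHm Es ?memvf // -exprM expnSr; congr (_ ^+ (_ * _)).
Qed.

Lemma galNorm_frob x :
  galNorm E {:L} x = \prod_(i < \dim_E {:L}) x ^+ ((#|F| ^ \dim E) ^ i).
Proof. exact: (big_Gal_frob _ id). Qed.

Lemma galTrace_frob x :
  galTrace E {:L} x = \sum_(i < \dim_E {:L}) x ^+ ((#|F| ^ \dim E) ^ i).
Proof. exact: (big_Gal_frob _ id). Qed.
End GaloisNorm.

Definition alg_closure (F : finFieldType) : countClosedFieldType :=
  tag (countable_algebraic_closure F).
Definition to_closure (F : finFieldType) : {rmorphism F -> alg_closure F} :=
  sval (tagged (countable_algebraic_closure F)).

(* F_{q^d} is the field of the roots of X^(q^d) - X in the algebraic closure
   of F = F_q. *)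
Section FiniteExtensions.
Variable F : finFieldType.
Local Notation q := #|F|.
Local Notation K := (alg_closure F).
Local Notation iota := (to_closure F).
Implicit Types (d e : degree) (x y : K).

Lemma pnat_q n : [pchar K].-nat (q ^ n)%N.
Proof.
have [p pr_p pcharFp] := finPcharP F.
have pcharKp : p \in [pchar K] by rewrite (fmorph_pchar iota).
have := abelem_pgroup (fin_ring_pchar_abelem pcharFp).
by rewrite (eq_pnat _ (pcharf_eq pcharKp)) pnatX /pgroup cardsT => ->.
Qed.

Lemma frobD n x y : (x + y) ^+ (q ^ n) = x ^+ (q ^ n) + y ^+ (q ^ n).
Proof. exact/exprDn_pchar/pnat_q. Qed.

Lemma frobN n x : (- x) ^+ (q ^ n) = - x ^+ (q ^ n).
Proof.
apply/eqP; rewrite -addr_eq0 -frobD addNr expr0n.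
by rewrite gtn_eqF // expn_gt0 (ltnW (finNzRing_gt1 F)).
Qed.

Definition GF_pred d := [pred x : K | x ^+ (q ^ d) == x].

Record GF d : predArgType := MkGF {GFval :> K; _ : GF_pred d GFval}.
HB.instance Definition _ d := [isSub for @GFval d].
HB.instance Definition _ d := [Choice of GF d by <:].
HB.instance Definition _ d := [Countable of GF d by <:].

Fact GF_divring_closed d : divring_closed (GF_pred d).
Proof.
split=> [|x y|x y]; rewrite !inE ?expr1n ?eqxx // => /eqP Ex /eqP Ey.
  by rewrite frobD frobN Ex Ey.
by rewrite expr_div_n Ex Ey.
Qed.
HB.instance Definition _ d :=
  GRing.isDivringClosed.Build K (GF_pred d) (GF_divring_closed d).
HB.instance Definition _ d := [SubChoice_isSubComUnitRing of GF d by <:].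
HB.instance Definition _ d := [SubComUnitRing_isSubIntegralDomain of GF d by <:].
HB.instance Definition _ d := [SubIntegralDomain_isSubField of GF d by <:].

Lemma GF_roots_subproof d : {r : seq K | {subset GF_pred d <= r}}.
Proof.
have q_d : (1 < q ^ d)%N.
  exact: leq_ltn_trans (deg_gt0 d) (ltn_expl d (finNzRing_gt1 F)).
pose p : {poly K} := 'X^(q ^ d) - 'X.
have [r Dp] := closed_field_poly_normal p; exists r => x.
rewrite !inE => /eqP Ex.
have sz_p : size p = (q ^ d).+1.
  by rewrite size_polyDl size_polyXn // size_polyN size_polyX ltnS q_d.
have nz_p : lead_coef p != 0 by rewrite lead_coef_eq0 -size_poly_eq0 sz_p.
rewrite -root_prod_XsubC -(rootZ _ _ nz_p) -Dp rootE !hornerE Ex subrr //.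
Qed.

Definition GF_enum d : seq (GF d) :=
  pmap insub (undup (sval (GF_roots_subproof d))).
Fact GF_enumP d : Finite.axiom (GF_enum d).
Proof.
apply: Finite.uniq_enumP => [|x].
  exact/pmap_sub_uniq/undup_uniq.
rewrite mem_pmap_sub mem_undup; apply: (svalP (GF_roots_subproof d)).
exact: valP x.
Qed.
HB.instance Definition _ d := isFinite.Build (GF d) (@GF_enumP d).

Lemma card_GF d : #|GF d| = (q ^ d)%N.
Proof.
have q_d : (1 < q ^ d)%N.
  exact: leq_ltn_trans (deg_gt0 d) (ltn_expl d (finNzRing_gt1 F)).
pose p : {poly K} := 'X^(q ^ d) - 'X.
have sz_p : size p = (q ^ d).+1.
  by rewrite size_polyDl size_polyXn // size_polyN size_polyX ltnS q_d.
have q0 : (q ^ d)%:R = 0 :> K.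
  have [r pr_r r_char] := finPcharP F.
  have rK : r \in [pchar K] by rewrite (fmorph_pchar (to_closure F)).
  apply/eqP; rewrite -(dvdn_pcharf rK).
  have := pnat_q d; rewrite (eq_pnat _ (pcharf_eq rK)) => /p_natP[[|n] En].
    by move: q_d; rewrite En.
  by rewrite En expnS dvdn_mulr.
have lead_p : lead_coef p = 1.
  by rewrite lead_coefDl ?lead_coefXn // size_polyXn size_polyN size_polyX ltnS q_d.
have [r Dp] := closed_field_poly_normal p; rewrite lead_p scale1r in Dp.
have r_uniq : uniq r.
  rewrite -separable_prod_XsubC -Dp unlock derivB derivXn derivX.
  by rewrite -mulr_natl -polyC_natr q0 mul0r sub0r -scaleN1r coprimepZr ?coprimep1 ?oppr_eq0 ?oner_eq0.
have sz_r : size r = (q ^ d)%N.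
  by apply: succn_inj; rewrite -sz_p Dp size_prod_XsubC.
rewrite -sz_r cardE -(size_map (@GFval d)); apply/perm_size/uniq_perm => //.
  by rewrite (map_inj_uniq val_inj) enum_uniq.
move=> x; rewrite -[_ \in r]root_prod_XsubC -Dp rootE !hornerE subr_eq0.
apply/mapP/idP=> [[y _ ->]|Ex]; first exact: (valP y).
by exists (MkGF (Ex : GF_pred d x)); rewrite ?mem_enum.
Qed.

Lemma GF_fix d (x : GF d) : GFval x ^+ (q ^ d) = GFval x.
Proof. exact/eqP/(valP x). Qed.

Fact in_GF_subproof d (a : F) : GF_pred d (iota a).
Proof.
rewrite inE -rmorphXn; apply/eqP; congr (iota _).
by elim: (d : nat) => [|n IHn]; rewrite ?expn0 // expnS exprM expf_card.
Qed.
Definition in_GF d (a : F) : GF d := MkGF (in_GF_subproof d a).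

(* The element of F whose image in the closure is y (0 if there is none). *)
Definition of_closure (y : K) : F := odflt 0 [pick z | iota z == y].

Lemma of_closureK y : y ^+ q = y -> iota (of_closure y) = y.
Proof.
move=> Ey; rewrite /of_closure; case: pickP => [z /eqP //|no_z].
have : (map_poly iota ('X^q - 'X)).[y] == 0.
  by rewrite rmorphB /= map_polyXn map_polyX !hornerE Ey subrr.
rewrite finField_genPoly rmorph_prod horner_prod prodf_seq_eq0 => /hasP[z _].
by rewrite rmorphB /= map_polyX map_polyC !hornerE subr_eq0 eq_sym /= no_z.
Qed.

Lemma to_closureK a : of_closure (iota a) = a.
Proof.
by apply: (fmorph_inj iota); rewrite of_closureK // -rmorphXn expf_card.
Qed.

Lemma frob_prod Q n x : x ^+ (Q ^ n) = x ->
  (\prod_(i < n) x ^+ (Q ^ i)) ^+ Q = \prod_(i < n) x ^+ (Q ^ i).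
Proof.
case: n => [|n] Ex; first by rewrite !big_ord0 expr1n.
rewrite -prodrXl big_ord_recr big_ord_recl /= -exprM -expnSr Ex expn0 expr1.
by rewrite mulrC; congr (_ * _); apply: eq_bigr => i _; rewrite -exprM -expnSr.
Qed.

Lemma frob_sum n x : x ^+ (q ^ n) = x ->
  (\sum_(i < n) x ^+ (q ^ i)) ^+ q = \sum_(i < n) x ^+ (q ^ i).
Proof.
move=> Ex; have frob1D y z : (y + z) ^+ q = y ^+ q + z ^+ q.
  by have := frobD 1 y z; rewrite expn1.
have q_gt0 : (0 < q)%N by rewrite ltnW ?finNzRing_gt1.
rewrite (big_morph (fun y => y ^+ q) frob1D (_ : _ = 0)); last first.
  by rewrite expr0n gtn_eqF.
case: n Ex => [|n] Ex; first by rewrite !big_ord0.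
rewrite big_ord_recr big_ord_recl /= -exprM -expnSr Ex expn0 expr1.
by rewrite addrC; congr (_ + _); apply: eq_bigr => i _; rewrite -exprM -expnSr.
Qed.

(* Products and sums over Gal(F_{q^d} / F_q), generated by x |-> x^q; compare
   galNorm_frob and galTrace_frob. *)
Definition norm d (x : GF d) : F := of_closure (\prod_(i < d) GFval x ^+ (q ^ i)).
Definition trace d (x : GF d) : F := of_closure (\sum_(i < d) GFval x ^+ (q ^ i)).

Lemma iota_norm d (x : GF d) : iota (norm x) = \prod_(i < d) GFval x ^+ (q ^ i).
Proof. exact/of_closureK/frob_prod/GF_fix. Qed.
Lemma iota_trace d (x : GF d) : iota (trace x) = \sum_(i < d) GFval x ^+ (q ^ i).
Proof. exact/of_closureK/frob_sum/GF_fix. Qed.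

Lemma norm0 d : norm (0 : GF d) = 0.
Proof.
apply: (fmorph_inj iota); rewrite iota_norm rmorph0 -(prednK (deg_gt0 d)).
by rewrite big_ord_recl expr1 mul0r.
Qed.
Lemma norm1 d : norm (1 : GF d) = 1.
Proof.
apply: (fmorph_inj iota); rewrite iota_norm rmorph1 big1 // => i _.
exact: expr1n.
Qed.
Lemma normM d : {morph @norm d : x y / x * y}.
Proof.
move=> x y; apply: (fmorph_inj iota); rewrite rmorphM !iota_norm -big_split.
by apply: eq_bigr => i _; rewrite /= exprMn.
Qed.

(* The norm F_{q^e} -> F_{q^d}; meaningful only if d %| e, see rel_normE. *)
Definition rel_norm d e (x : GF e) : GF d :=
  insubd 0 (\prod_(i < e %/ d) GFval x ^+ ((q ^ d) ^ i)).

Lemma rel_normE d e (x : GF e) : (d %| e)%N ->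
  GFval (rel_norm d x) = \prod_(i < e %/ d) GFval x ^+ ((q ^ d) ^ i).
Proof.
move=> de; rewrite [GFval _]insubdK // inE; apply/eqP/frob_prod.
by rewrite -expnM mulnC divnK // GF_fix.
Qed.

Lemma rel_norm0 d e : (d %| e)%N -> rel_norm d (0 : GF e) = 0.
Proof.
move=> de; apply: val_inj; rewrite /= rel_normE //.
have: (0 < e %/ d)%N by rewrite divn_gt0 ?deg_gt0 // dvdn_leq ?deg_gt0.
by case: (e %/ d)%N => // n _; rewrite big_ord_recl expr1 mul0r.
Qed.
Lemma rel_norm1 d e : (d %| e)%N -> rel_norm d (1 : GF e) = 1.
Proof.
move=> de; apply: val_inj; rewrite /= rel_normE // big1 // => i _.
exact: expr1n.
Qed.
Lemma rel_normM d e : (d %| e)%N -> {morph @rel_norm d e : x y / x * y}.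
Proof.
move=> de x y; apply: val_inj; rewrite /= !rel_normE // -big_split.
by apply: eq_bigr => i _; rewrite /= exprMn.
Qed.

Lemma rel_norm_id d (x : GF d) : rel_norm d x = x.
Proof.
apply: val_inj; rewrite /= rel_normE // divnn deg_gt0 big_ord1.
by rewrite expn0 expr1.
Qed.

Lemma rel_norm_trans d e f (x : GF f) : (d %| e)%N -> (e %| f)%N ->
  rel_norm d (rel_norm e x) = rel_norm d x.
Proof.
move=> de ef; have df := dvdn_trans de ef.
apply: val_inj; rewrite /= !rel_normE //.
have -> : (f %/ d = (f %/ e) * (e %/ d))%N.
  by rewrite muln_divA // divnK.
under eq_bigr do rewrite -prodrXl.
rewrite exchange_big -(big_mkord xpredT (fun k => GFval x ^+ ((q ^ d) ^ k))).
rewrite big_nat_mul big_mkord /=.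
apply: eq_bigr => i _; rewrite -[X in \prod_(X <= _ < _) _]add0n big_addn.
rewrite mulSn addnK big_mkord; apply: eq_bigr => j _; rewrite -exprM.
rewrite -!expnM -expnD; congr (_ ^+ (_ ^ _)).
by rewrite mulnDr mulnCA (mulnC d (_ %/ d)%N) divnK // [RHS]addnC (mulnC i).
Qed.

Lemma norm_rel_norm d e (x : GF e) : (d %| e)%N ->
  norm (rel_norm d x) = norm x.
Proof.
have norm_rel c (y : GF c) : iota (norm y) = GFval (rel_norm deg1 y).
  by rewrite iota_norm rel_normE ?dvd1n // divn1 expn1.
move=> de; apply: (fmorph_inj iota).
by rewrite !norm_rel rel_norm_trans ?dvd1n.
Qed.
End FiniteExtensions.

Section CharacterLimit.
Variables (F : finFieldType) (C : fieldType).
Local Notation charGF d := (mulchar (GF F d) C).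
Implicit Types (d e : degree).

Definition norm_char d (chi : mulchar F C) : charGF d :=
  pullback (@norm0 F d) (@norm1 F d) (@normM F d) chi.

Definition lift_char d e (de : (d %| e)%N) (chi : charGF d) : charGF e :=
  pullback (rel_norm0 F de) (rel_norm1 F de) (rel_normM de) chi.

Lemma lift_charE d e (de : (d %| e)%N) chi x :
  lift_char de chi x = chi (rel_norm d x).
Proof. exact: pullbackE. Qed.

Lemma lift_char_id d (dd : (d %| d)%N) chi : lift_char dd chi = chi.
Proof. by apply: mulchar_inj => x; rewrite lift_charE rel_norm_id. Qed.

Lemma lift_char_trans d e (f : degree) (de : (d %| e)%N) (ef : (e %| f)%N) (df : (d %| f)%N) chi :
  lift_char ef (lift_char de chi) = lift_char df chi.
Proof. by apply: mulchar_inj => x; rewrite !lift_charE rel_norm_trans. Qed.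

Lemma lift_charM d e (de : (d %| e)%N) chi chi' :
  lift_char de (chi * chi')%g = (lift_char de chi * lift_char de chi')%g.
Proof. by apply: mulchar_inj => x; rewrite mulcharMgE !lift_charE mulcharMgE. Qed.

Lemma lift_charV d e (de : (d %| e)%N) chi :
  lift_char de (chi^-1)%g = ((lift_char de chi)^-1)%g.
Proof. by apply: mulchar_inj => x; rewrite mulcharVgE !lift_charE mulcharVgE. Qed.

Lemma lift_norm_char d e (de : (d %| e)%N) chi :
  lift_char de (norm_char d chi) = norm_char e chi.
Proof.
by apply: mulchar_inj => x; rewrite lift_charE !pullbackE norm_rel_norm.
Qed.

(* X is the quotient of the disjoint union of the X_d that identifies two
   characters when their pullbacks to some common F_{q^e} agree. *)
Definition prechar := {d : degree & charGF d}.

Definition prechar_eqv (u v : prechar) : bool :=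
  `[< exists e (ue : (tag u %| e)%N) (ve : (tag v %| e)%N),
        lift_char ue (tagged u) = lift_char ve (tagged v) >].

Fact prechar_eqv_refl : reflexive prechar_eqv.
Proof. by move=> u; apply/asboolP; exists (tag u), (dvdnn _), (dvdnn _). Qed.
Fact prechar_eqv_sym : symmetric prechar_eqv.
Proof.
by move=> u v; apply/asboolP/asboolP=> -[e [ue [ve uv]]]; exists e, ve, ue.
Qed.
Fact prechar_eqv_trans : transitive prechar_eqv.
Proof.
move=> v u w /asboolP[e [ue [ve uv]]] /asboolP[f [vf [wf vw]]].
have [eef fef] : (e %| degM e f)%N /\ (f %| degM e f)%N.
  by rewrite dvdn_mulr ?dvdn_mull.
apply/asboolP; exists (degM e f), (dvdn_trans ue eef), (dvdn_trans wf fef).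
rewrite -(lift_char_trans ue eef) uv (lift_char_trans _ _ (dvdn_trans vf fef)).
by rewrite -(lift_char_trans vf fef) vw (lift_char_trans _ _ (dvdn_trans wf fef)).
Qed.
Canonical prechar_equiv :=
  EquivRel prechar_eqv prechar_eqv_refl prechar_eqv_sym prechar_eqv_trans.

Definition charlim := {eq_quot prechar_eqv}%qT.
HB.instance Definition _ := EqQuotient.on charlim.
HB.instance Definition _ := Choice.on charlim.

Definition char_class d (chi : charGF d) : charlim :=
  (\pi_charlim (Tagged (fun d => charGF d) chi))%qT.

Lemma char_class_eq d e chi psi :
  reflect (exists (f : degree) (df : (d %| f)%N) (ef : (e %| f)%N),
             lift_char df chi = lift_char ef psi)
          (char_class chi == char_class psi :> charlim).
Proof. by rewrite /char_class eqquotE; apply: asboolP. Qed.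

Lemma char_class_lift d e (de : (d %| e)%N) chi :
  char_class (lift_char de chi) = char_class chi.
Proof.
apply/eqP/char_class_eq; exists e, (dvdnn e), de.
exact: lift_char_id.
Qed.

Lemma char_classP (a : charlim) : exists d chi, a = @char_class d chi.
Proof.
rewrite -[a]reprK; case: (repr a) => d chi.
by exists d, chi.
Qed.

Definition charlim_one : charlim := char_class (1%g : charGF deg1).
Definition charlim_mul (a b : charlim) : charlim :=
  let: existT d chi := repr a in let: existT e psi := repr b in
  char_class (lift_char (dvdn_mulr e (dvdnn d) : (d %| degM d e)%N) chi
            * lift_char (dvdn_mull d (dvdnn e) : (e %| degM d e)%N) psi)%g.
Definition charlim_inv (a : charlim) : charlim :=
  let: existT d chi := repr a in char_class (chi^-1)%g.

Lemma charlim_mulE d (chi psi : charGF d) :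
  charlim_mul (char_class chi) (char_class psi) = char_class (chi * psi)%g.
Proof.
rewrite /charlim_mul.
case Ea: (repr (char_class chi)) => [d1 chi1].
case Eb: (repr (char_class psi)) => [d2 psi2].
have /eqP/char_class_eq[e [d1e [de Echi]]] : char_class chi1 = char_class chi.
  by rewrite -[RHS]reprK Ea.
have /eqP/char_class_eq[f [d2f [df Epsi]]] : char_class psi2 = char_class psi.
  by rewrite -[RHS]reprK Eb.
set h1 := (X in lift_char X _); set h2 := (X in (_ * lift_char X _)%g).
pose g := degM (degM e f) (degM d1 d2).
have eg : (e %| g)%N by rewrite /= dvdn_mulr ?dvdn_mulr.
have fg : (f %| g)%N by rewrite /= dvdn_mulr ?dvdn_mull.
have dg : (d %| g)%N := dvdn_trans de eg.
have mg : (degM d1 d2 %| g)%N by rewrite /= dvdn_mull.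
rewrite -(char_class_lift dg) -(char_class_lift mg) !lift_charM.
rewrite (lift_char_trans _ _ (dvdn_trans d1e eg)).
rewrite (lift_char_trans _ _ (dvdn_trans d2f fg)).
rewrite -(lift_char_trans d1e eg) Echi -(lift_char_trans d2f fg) Epsi.
by rewrite !(lift_char_trans _ _ dg).
Qed.

Lemma charlim_invE d (chi : charGF d) :
  charlim_inv (char_class chi) = char_class (chi^-1)%g.
Proof.
rewrite /charlim_inv; case Ea: (repr (char_class chi)) => [e psi].
have /eqP/char_class_eq[f [ef [df E]]] : char_class psi = char_class chi.
  by rewrite -[RHS]reprK Ea.
by rewrite -(char_class_lift ef) -(char_class_lift df) !lift_charV E.
Qed.

Lemma charlim_oneE d : charlim_one = char_class (1%g : charGF d).
Proof.
have d1 : (deg1 %| d)%N := dvd1n d.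
rewrite /charlim_one -(char_class_lift d1); congr char_class.
by rewrite -[1%g in LHS](mulgV (1%g : charGF deg1)) lift_charM lift_charV mulgV.
Qed.

Lemma charlim_common (a b : charlim) :
  exists d chi psi, a = @char_class d chi /\ b = @char_class d psi.
Proof.
have [[d [chi ->]] [e [psi ->]]] := (char_classP a, char_classP b).
have dg : (d %| degM d e)%N by rewrite dvdn_mulr.
have eg : (e %| degM d e)%N by rewrite dvdn_mull.
exists (degM d e), (lift_char dg chi), (lift_char eg psi).
by rewrite !char_class_lift.
Qed.

Fact charlim_mulC : commutative charlim_mul.
Proof.
move=> a b; have [d [chi [psi [-> ->]]]] := charlim_common a b.
rewrite !charlim_mulE; congr char_class; exact: mulchar_mulC.
Qed.
Fact charlim_mulA : associative charlim_mul.
Proof.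
move=> a b c; have [d [chi [psi [-> ->]]]] := charlim_common a b.
have [e [om ->]] := char_classP c.
have dg : (d %| degM d e)%N by rewrite dvdn_mulr.
have eg : (e %| degM d e)%N by rewrite dvdn_mull.
rewrite -(char_class_lift dg chi) -(char_class_lift dg psi) -(char_class_lift eg).
by rewrite !charlim_mulE mulgA.
Qed.
Fact charlim_mul1 : left_id charlim_one charlim_mul.
Proof.
move=> a; have [d [chi ->]] := char_classP a.
by rewrite (charlim_oneE d) charlim_mulE mul1g.
Qed.
Fact charlim_mulV : left_inverse charlim_one charlim_inv charlim_mul.
Proof.
move=> a; have [d [chi ->]] := char_classP a.
by rewrite charlim_invE charlim_mulE mulVg (charlim_oneE d).
Qed.

HB.instance Definition _ := isGroup.Build charlim
  charlim_mulA charlim_mul1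
  (fun a => etrans (charlim_mulC _ _) (charlim_mul1 a))
  charlim_mulV (fun a => etrans (charlim_mulC _ _) (charlim_mulV a)).

(* norm_char deg1 transports chi along the isomorphism F_{q^1} -> F. *)
Definition base_class (chi : mulchar F C) : charlim :=
  char_class (norm_char deg1 chi).

Lemma base_classE d (chi : mulchar F C) :
  base_class chi = char_class (norm_char d chi).
Proof.
by rewrite -(lift_norm_char (dvd1n d : (deg1 %| d)%N)) char_class_lift.
Qed.

Lemma char_classX d (f : charGF d) n :
  (char_class f ^+ n)%g = char_class (f ^+ n)%g.
Proof.
elim: n => [|n IHn]; first by rewrite !expg0 -charlim_oneE.
by rewrite !expgS IHn; apply: charlim_mulE.
Qed.

Lemma lift_charX d e (de : (d %| e)%N) (f : charGF d) n :
  lift_char de (f ^+ n)%g = (lift_char de f ^+ n)%g.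
Proof.
elim: n => [|n IHn]; last by rewrite !expgS lift_charM IHn.
by rewrite !expg0 -[1%g in LHS](mulgV (1%g : charGF d)) lift_charM lift_charV mulgV.
Qed.

Lemma char_roots_level d (chi : charGF d) m (s : seq charlim) :
  {in s, forall xi, (xi ^+ m)%g = char_class chi} ->
  exists e (de : (d %| e)%N) (t : seq (charGF e)),
    s = [seq char_class f | f <- t]
    /\ {in t, forall f, (f ^+ m)%g = lift_char de chi}.
Proof.
elim: s => [|xi s IHs] Es; first by exists d, (dvdnn d), [::].
have [|e [de [t [-> Et]]]] := IHs; first by move=> z sz; rewrite Es ?inE ?sz ?orbT.
have [c [f Exi]] := char_classP xi.
have /eqP := Es _ (mem_head _ _); rewrite Exi char_classX.
case/char_class_eq=> b [cb [db Ef]].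
have bg : (b %| degM b e)%N by rewrite dvdn_mulr.
have eg : (e %| degM b e)%N by rewrite dvdn_mull.
exists (degM b e), (dvdn_trans de eg).
exists (lift_char (dvdn_trans cb bg) f :: [seq lift_char eg h | h <- t]).
split=> [|h].
  rewrite /= char_class_lift -map_comp; congr (_ :: _).
  by apply: eq_map => h /=; rewrite char_class_lift.
rewrite inE => /predU1P[->|/mapP[h' th' ->]]; rewrite -lift_charX.
  by rewrite -(lift_char_trans cb bg) Ef (lift_char_trans db bg (dvdn_trans de eg)).
by rewrite Et // (lift_char_trans _ _ (dvdn_trans de eg)).
Qed.

Lemma finite_char_roots (chi : charlim) m : (0 < m)%N ->
  finite_set [set xi | (xi ^+ m)%g = chi]%classic.
Proof.
move=> m_gt0; apply: contrapT => /(infinite_set_fset m.+1)[B sB].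
rewrite leqNgt => /negP; apply; rewrite ltnS.
have [d [chi' Echi]] := char_classP chi; rewrite {chi}Echi in sB *.
have [xi /sB//|e [de [t [EB Et]]]] := @char_roots_level d chi' m (enum_fset B).
rewrite EB size_map -ltnS.
have t_uniq : uniq t by apply: (@map_uniq _ _ (@char_class e)); rewrite -EB fset_uniq.
have /cyclicP[g Dg] := field_unit_group_cyclic [group of [set: {unit GF F e}]].
pose v (f : charGF e) := f (val g).
have v_inj : injective v.
  move=> f h Efh; apply: mulchar_inj => x.
  have [->|nz_x] := eqVneq x 0; first by rewrite !mulchar0.
  have : finField_unit nz_x \in <[g]>%g by rewrite -Dg inE.
  case/cycleP=> n /(congr1 val) /= ->; rewrite FinRing.val_unitX.
  by elim: n => [|n IHn]; rewrite ?expr0 ?mulchar1 // exprS !mulcharM IHn [f _]Efh.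
have v_root f : f \in t -> root ('X^m - (v (lift_char de chi'))%:P) (v f).
  move=> /Et <-; rewrite rootE !hornerE subr_eq0; apply/eqP.
  elim: (m) => [|n IHn]; last by rewrite exprS expgS /v mulcharMgE IHn.
  rewrite expr0 expg0 /v mulchar1gE (_ : val g != 0) //.
  by rewrite -unitfE (valP g).
have := @max_poly_roots _ ('X^m - (v (lift_char de chi'))%:P) (map v t).
rewrite size_map size_XnsubC //; apply.
- by rewrite -size_poly_eq0 size_XnsubC.
- by apply/allP=> _ /mapP[f tf ->]; apply: v_root.
- by rewrite map_inj_uniq.
Qed.

(* The sum ranges over a finite set by finite_char_roots. *)
Definition div_pos (chi : charlim) (m : nat) : {freeg charlim} :=
  \sum_(xi \in [set xi : charlim | (xi ^+ m)%g = chi]%classic)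
     (<< xi >> : {freeg charlim}).

Definition divD (chi : charlim) (n : int) : {freeg charlim} :=
  match n with
  | Posz m => div_pos chi m
  | Negz m => - div_pos (chi^-1)%g m.+1
  end.

End CharacterLimit.

(* Main.v *)
Require Import Defs.
From HB Require Import structures.
From mathcomp Require Import all_boot all_order all_algebra all_fingroup.
From mathcomp Require Import all_solvable all_field.
From mathcomp Require Import boolp classical_sets cardinality fsbigop.
From mathcomp Require Import reals complex finmap freeg zify.

Set Implicit Arguments.
Unset Strict Implicit.
Unset Printing Implicit Defensive.

(** The idea is to look at the identity through the valuation of a prime above
    the characteristic p.

    Let q = p^s and let tau be the inverse of the Teichmueller character of
    F_{q^d}, so that every character is a power of tau.  Stickelberger's
    congruence says that, up to factors which are units at the chosen prime, the
    Gauss sum of tau^a is w^{s_p(a)}, where w is the Gauss sum of tau,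
    0 <= a < q^d - 1 and s_p is the sum of the base-p digits (lemma
    [stickelberger]).  It follows from two relations: the Jacobi sum of tau^a and
    tau reduces to -(a+1), which gives the step from a to a+1 when p does not
    divide a+1, and the Frobenius gives the step from a to pa.  Hence in the
    identity the exponent of w on the left, a sum of k digit sums, is the same
    for all admissible lambda, since c^d is fixed and lambda(a) is a root of
    unity.

    To find the coefficient of the divisor at a point xi, choose a level d0 at
    which xi and all the relations xi^{n_i} = chi_i that hold are visible, put
    B = q^{d0}, and take d = d0 T with T large.  The characters
    kappa_i = xi^{-n_i} chi_i are killed by B - 1, so kappa_i = tau^{eps_i R} with
    R = 1 + B + ... + B^{T-1}: all base-B digits of the exponent are equal.  Now
    evaluate the identity at lambda = tau^{B^t - 1} xi^{-1} for two consecutive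
    values of t.  For n = n_i > 0 the i-th Gauss sum has exponent
    n (B^t - 1) + eps_i R.  If eps_i is not 0, passing from t to t + 1 only moves
    one digit eps_i from one block of digits to another, and the digit sum is
    unchanged.  If eps_i = 0 then the digit sum of n (B^t - 1) is that of B^t - 1,
    hence grows by the constant (p - 1) s d0 (lemma [digit_sum_block_exp]).  For
    n_i < 0 the exponents are complementary and the sign changes.  So the
    constancy of the total says that (p - 1) s d0 times the sum of the signs of the n_i with
    xi^{n_i} = chi_i vanishes, and that sum of signs is the coefficient of xi.

    No valuation has to be constructed.  Fix a root of unity zeta in C and an
    element z of an algebraic closure of F_q such that every integral polynomial
    vanishing at zeta vanishes at z; the relation [reduces_to zeta z] is then the reduction map of Z[zeta], and [reduction_unit zeta z] describes
    the units of the corresponding local ring.  The comparison of two powers of w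
    only uses that w reduces to 0. *)

(** * Digit sums in base p *)

Section DigitSum.
Variable p : nat.
Hypothesis p_gt1 : 1 < p.

(** The digits of index a and above vanish, because a < p^a. *)
Definition digit_sum (a : nat) : nat := \sum_(j < a) (a %/ p ^ j) %% p.

Lemma digit_sum_bound N a : a < p ^ N ->
  digit_sum a = \sum_(j < N) (a %/ p ^ j) %% p.
Proof.
have big_eq n m : m <= n -> a < p ^ m ->
    \sum_(j < n) (a %/ p ^ j) %% p = \sum_(j < m) (a %/ p ^ j) %% p.
  move=> le_mn lt_a; rewrite -(subnKC le_mn) big_split_ord /=.
  rewrite [X in _ + X]big1 ?addn0 // => i _.
  rewrite divn_small ?mod0n //; apply: (leq_trans lt_a).
  by rewrite leq_pexp2l ?leq_addr // ltnW.
move=> lt_aN; rewrite /digit_sum; have [le_aN|lt_Na] := leqP a N.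
  by rewrite (big_eq N a) // ltn_expl.
by rewrite (big_eq a N) // ltnW.
Qed.

Lemma digit_sumMD r b : r < p -> digit_sum (p * b + r) = digit_sum b + r.
Proof.
move=> lt_r; have lt_b : b < p ^ b by rewrite ltn_expl.
have lt_pb : p * b + r < p ^ b.+1.
  rewrite expnS (@leq_trans (p * b.+1)) //; last by rewrite leq_mul2l lt_b orbT.
  by rewrite mulnS [p + _]addnC ltn_add2l.
rewrite (digit_sum_bound lt_pb) (digit_sum_bound lt_b) big_ord_recl /=.
rewrite expn0 divn1 addnC [p * b]mulnC modnMDl modn_small //; congr (_ + _).
apply: eq_bigr => i _; rewrite /bump /= add1n expnS divnMA divnMDl ?(divn_small lt_r) ?addn0 //.
exact: ltnW.
Qed.

Lemma digit_sum0 : digit_sum 0 = 0. Proof. exact: big_ord0. Qed.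

Lemma digit_sumM b : digit_sum (p * b) = digit_sum b.
Proof. by have := @digit_sumMD 0 b (ltnW p_gt1); rewrite !addn0. Qed.

Lemma digit_sumS a : ~~ (p %| a.+1) -> digit_sum a.+1 = (digit_sum a).+1.
Proof.
have lt_a : a %% p < p by rewrite ltn_mod ltnW.
have Da : a = p * (a %/ p) + a %% p by rewrite mulnC -divn_eq.
have Da1 : a.+1 = p * (a %/ p) + (a %% p).+1 by rewrite addnS -Da.
rewrite Da1; have [lt_a1 _|le_a1] := ltnP (a %% p).+1 p.
  by rewrite [in RHS]Da !digit_sumMD // addnS.
have -> : (a %% p).+1 = p by apply/eqP; rewrite eqn_leq lt_a.
by rewrite dvdn_addl ?dvdnn ?dvdn_mulr.
Qed.

Lemma digit_sum_cat N u v : u < p ^ N ->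
  digit_sum (v * p ^ N + u) = digit_sum v + digit_sum u.
Proof.
elim: N u v => [|N IHN] u v.
  by rewrite expn0 ltnS leqn0 muln1 => /eqP->; rewrite digit_sum0 !addn0.
rewrite expnS => lt_u; have p_gt0 := ltnW p_gt1.
have lt_r : u %% p < p by rewrite ltn_mod.
have lt_uN : u %/ p < p ^ N by rewrite ltn_divLR // mulnC.
rewrite {1 2}(divn_eq u p).
have -> : v * (p * p ^ N) + (u %/ p * p + u %% p)
        = p * (v * p ^ N + u %/ p) + u %% p by lia.
by rewrite [u %/ p * p]mulnC !digit_sumMD // IHN // addnA.
Qed.

(** Subtraction from p^N - 1 replaces each of the N digits c by p - 1 - c,
    without borrowing. *)
Lemma digit_sum_compl N u : u < p ^ N ->
  digit_sum ((p ^ N).-1 - u) + digit_sum u = N * p.-1.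
Proof.
elim: N u => [|N IHN] u.
  by rewrite expn0 ltnS leqn0 => /eqP->; rewrite digit_sum0.
rewrite expnS => lt_u; have p_gt0 := ltnW p_gt1.
have lt_r : u %% p < p by rewrite ltn_mod.
have lt_uN : u %/ p < p ^ N by rewrite ltn_divLR // mulnC.
have pN_gt0 : 0 < p ^ N by rewrite expn_gt0 p_gt0.
rewrite [in X in _ + X](divn_eq u p) [u %/ p * p]mulnC.
have -> : (p * p ^ N).-1 - u = p * ((p ^ N).-1 - u %/ p) + (p.-1 - u %% p).
  by rewrite {1}(divn_eq u p); nia.
rewrite !digit_sumMD //; last by lia.
have := IHN _ lt_uN; rewrite mulSn; lia.
Qed.

End DigitSum.

(** (B^n - 1) / (B - 1), the number with n base-B digits equal to 1. *)
Definition repunit (B n : nat) : nat := \sum_(i < n) B ^ i.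

Lemma repunitS B n : repunit B n.+1 = repunit B n + B ^ n.
Proof. exact: big_ord_recr. Qed.

Lemma repunitD B m n : repunit B (m + n) = repunit B m + repunit B n * B ^ m.
Proof.
rewrite /repunit big_split_ord /= big_distrl; congr (_ + _).
by apply: eq_bigr => i _; rewrite expnD mulnC.
Qed.

Lemma repunitM B n : 0 < B -> B.-1 * repunit B n = (B ^ n).-1.
Proof. by move=> B_gt0; rewrite predn_exp. Qed.

Section RepunitBlocks.
Variables p h : nat.
Hypotheses (p_gt1 : 1 < p) (h_gt0 : 0 < h).
Local Notation B := (p ^ h).
Local Notation s := (digit_sum p).

Variables (r m eps : nat).
Hypotheses (m_gt0 : 0 < m) (m_le : m <= B ^ r) (eps_lt : eps < B.-1).
Let T := r.+1 + r.+2.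
(** The exponent of the i-th Gauss sum at lambda = tau^{B^t - 1} xi^{-1}, where
    m = n_i > 0 and xi^{-m} chi_i = tau^{eps R}. *)
Definition block_exp t := m * (B ^ t).-1 + eps * repunit B T.

Let B_gt1 : 1 < B. Proof. by rewrite -(expn0 p) ltn_exp2l. Qed.
Let B_gt0 : 0 < B. Proof. exact: ltnW. Qed.
Let BX_gt0 n : 0 < B ^ n. Proof. by rewrite expn_gt0 B_gt0. Qed.

Lemma block_exp_gt0 t : 0 < t -> 0 < block_exp t.
Proof.
move=> t_gt0; rewrite addn_gt0 muln_gt0 m_gt0 /=; apply/orP; left.
have : 1 < B ^ t by rewrite -(expn0 B) ltn_exp2l.
by case: (B ^ t) => // -[].
Qed.

Let digit_block n : eps * repunit B n + repunit B n <= (B ^ n).-1.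
Proof. by rewrite -repunitM // -mulSnr leq_mul2r eps_lt orbT. Qed.

Let m_le_rep t : r < t -> m <= repunit B t.
Proof.
case: t => // t; rewrite ltnS => le_rt; rewrite repunitS.
apply: (leq_trans m_le); apply: (leq_trans _ (leq_addl _ _)).
by rewrite leq_pexp2l.
Qed.

(** The digits eps below the block boundary B^t absorb the subtraction of m, and
    those above absorb the addition of m. *)
Let splitE t u : 0 < eps -> r < t -> t + u = T ->
  block_exp t = (eps * repunit B u + m) * B ^ t + (eps * repunit B t - m).
Proof.
move=> eps_gt0 lt_rt DT; rewrite /block_exp -DT addnC repunitD.
have le1 := m_le_rep lt_rt.
have le2 : repunit B t <= eps * repunit B t by rewrite leq_pmull.
have le3 : m <= m * B ^ t by rewrite leq_pmulr.
rewrite -subn1 mulnBr muln1 mulnDl mulnDr mulnA; lia.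
Qed.

(** Here m (B^t - 1) consists of the digits of m - 1 above those of its
    complement, so its digit sum does not depend on m. *)
Let split0 t : eps = 0 -> r < t ->
  block_exp t = m.-1 * B ^ t + ((B ^ t).-1 - m.-1) /\ m.-1 < B ^ t.
Proof.
move=> eps0 lt_rt; rewrite /block_exp eps0 mul0n addn0.
have le_m : m <= B ^ t by rewrite (leq_trans m_le) // leq_pexp2l // ltnW.
have := BX_gt0 t; split; nia.
Qed.

Lemma block_exp_lt t : r < t -> t <= r.+2 -> block_exp t < (B ^ T).-1.
Proof.
move=> lt_rt le_t; have [eps0|eps_gt0] := posnP eps.
  have [-> lt_m] := split0 eps0 lt_rt.
  have : B ^ r * B ^ t <= B ^ (r + r.+2) by rewrite -expnD leq_pexp2l // leq_add2l.
  have -> : B ^ T = B * B ^ (r + r.+2) by rewrite -expnS.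
  have := BX_gt0 t; have := BX_gt0 (r + r.+2).
  nia.
have [u DT] : {u | t + u = T} by exists (T - t); rewrite /T; lia.
have lt_ru : r < u by move: DT; rewrite /T; lia.
rewrite (splitE eps_gt0 lt_rt DT) -DT addnC expnD.
have := digit_block u; have := digit_block t.
have := m_le_rep lt_rt; have := m_le_rep lt_ru.
have := BX_gt0 t; have := BX_gt0 u.
set bu := B ^ u; set bt := B ^ t; set ru := repunit B u; set rt := repunit B t.
set eu := eps * ru; set et := eps * rt => bu0 bt0 mu mt Ht Hu.
have : (eu + m).+1 * bt <= bu * bt by rewrite leq_mul2r; lia.
rewrite mulSn; lia.
Qed.

(** When eps is not 0, the two blocks of the exponent have lengths r + 1 and
    r + 2 in one order or the other, and lengthening a block by one adds a digit
    eps to it, so both choices of t give the same total. *)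
Lemma digit_sum_block_exp :
  s (block_exp r.+2) = s (block_exp r.+1) + (eps == 0) * (h * p.-1).
Proof.
have BXE n : B ^ n = p ^ (h * n) by rewrite -expnM.
have [eps0|eps_gt0] := posnP eps.
  rewrite mul1n.
  have E t : r < t -> s (block_exp t) = h * t * p.-1.
    move=> lt_rt; have [-> lt_m] := split0 eps0 lt_rt.
    have := digit_sum_compl p_gt1 (u := m.-1) (N := h * t).
    rewrite -BXE => /(_ lt_m) <-.
    by rewrite {1}BXE digit_sum_cat // -?BXE; lia.
  by rewrite !E //; lia.
rewrite mul0n addn0.
rewrite (@splitE r.+1 r.+2) // (@splitE r.+2 r.+1) //; last by rewrite /T addnC.
have lt_eps : eps < B by rewrite (leq_trans eps_lt) // leq_pred.
have low t : r < t -> eps * repunit B t - m < B ^ t.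
  move=> lt_rt; have := digit_block t; have := BX_gt0 t; have := m_le_rep lt_rt; lia.
have lowD t : r < t -> eps * repunit B t + m < B ^ t.
  move=> lt_rt; have := digit_block t; have := BX_gt0 t; have := m_le_rep lt_rt; lia.
have catB n u v : u < B ^ n -> s (v * B ^ n + u) = s v + s u.
  by rewrite BXE; apply: digit_sum_cat.
have le_m : m <= eps * repunit B r.+1.
  by rewrite (leq_trans (m_le_rep (ltnSn r))) // leq_pmull.
rewrite !catB ?low //.
have -> : eps * repunit B r.+2 + m = eps * B ^ r.+1 + (eps * repunit B r.+1 + m).
  by rewrite repunitS mulnDr [_ + eps * _]addnC addnA.
have -> : eps * repunit B r.+2 - m = eps * B ^ r.+1 + (eps * repunit B r.+1 - m).
  by rewrite repunitS mulnDr addnBA // addnC.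
by rewrite !catB ?low ?lowD // addnCA addnA.
Qed.

End RepunitBlocks.

(** * Reduction of cyclotomic integers modulo a prime above p *)

Import GRing.Theory Num.Theory.
Local Open Scope ring_scope.

(** The roots of X^n - 1 are distinct in characteristic 0, and a group of n
    distinct n-th roots of unity in a field is cyclic. *)
Lemma closed_prim_root_exists (C : closedFieldType) n :
  [pchar C] =i pred0 -> (0 < n)%N -> exists z : C, n.-primitive_root z.
Proof.
move=> char0 n_gt0; have [r Dr] := closed_field_poly_normal ('X^n - 1 : {poly C}).
have sz_p : size ('X^n - 1 : {poly C}) = n.+1 by rewrite size_XnsubC.
rewrite (monicP (monic_Xn_sub_1 _ n_gt0)) scale1r in Dr.
have r_unity : all n.-unity_root r.
  by apply/allP=> x rx; rewrite /root_of_unity Dr root_prod_XsubC.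
have r_uniq : uniq r.
  rewrite -separable_prod_XsubC -Dr unlock derivB derivXn derivC subr0.
  apply/coprimepP=> q q_dvd1; rewrite -mulr_natl -polyC_natr mul_polyC.
  rewrite dvdpZr; last by move/pcharf0P: char0 => ->; rewrite -lt0n.
  move=> q_dvdX; have : q %| 1%:P.
    have -> : 1%:P = 'X * 'X^(n.-1) - ('X^n - 1) :> {poly C}.
      by rewrite -exprS prednK // opprB addrC subrK.
    by rewrite dvdp_sub // dvdp_mull.
  by rewrite polyC1 dvdp1 size_poly_eq1.
have r_size : (n <= size r)%N.
  by rewrite -ltnS -sz_p Dr size_prod_XsubC.
by have /hasP[z _ zP] := has_prim_root n_gt0 r_unity r_uniq r_size; exists z.
Qed.

(** A prime of Z[zeta] with residue field inside K.  By Gauss's lemma the integral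
    polynomials vanishing at zeta are the multiples of a primitive one of minimal
    degree, and this one has an invertible leading coefficient because it
    divides X^M - 1; hence it keeps its degree in K and has a root z there. *)
Lemma compatible_root (C : numFieldType) (K : closedFieldType) (zeta : C) M :
    (0 < M)%N -> zeta ^+ M = 1 ->
  exists z : K, forall f : {poly int},
    (map_poly intr f).[zeta] = 0 -> (map_poly intr f).[z] = 0.
Proof.
move=> M_gt0 zetaM; pose vanish (f : {poly int}) := (map_poly intr f).[zeta] == 0.
have vanM : vanish ('X^M - 1).
  rewrite /vanish rmorphB /= map_polyXn rmorph1 !hornerE zetaM subrr //.
pose P n := `[< exists f : {poly int}, [/\ f != 0, vanish f & size f = n] >].
have exP : exists n, P n.
  exists M.+1; apply/asboolP; exists ('X^M - 1); split=> //; last exact: size_XnsubC.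
  by rewrite monic_neq0 // monic_Xn_sub_1.
case: (ex_minnP exP) => n /asboolP[g [g_neq0 vang sz_g]] min_n.
pose phi := zprimitive g.
have van_phi : vanish phi.
  move: vang; rewrite /vanish {1}[g]zpolyEprim -mul_polyC rmorphM /= map_polyC.
  by rewrite !hornerE mulf_eq0 intr_eq0 zcontents_eq0 (negPf g_neq0).
have phi_dvd f : vanish f -> exists h, f = phi * h.
  move=> vanf; suff /dvdpP_int[h ->] : Pdiv.Idomain.dvdp g f by exists h.
  apply/Pdiv.Idomain.modp_eq0P/eqP; apply: contraT => r_neq0.
  have := Pdiv.Idomain.ltn_modpN0 f g_neq0; rewrite ltnNge sz_g min_n //.
  apply/asboolP; exists (Pdiv.Idomain.modp f g); split=> //.
  move/eqP: vang => vang; move/eqP: vanf => vanf.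
  have := congr1 (fun p => (map_poly intr p).[zeta]) (Pdiv.Idomain.divp_eq f g).
  rewrite -mul_polyC rmorphM rmorphD rmorphM /= !hornerE vanf vang !mulr0 add0r.
  by rewrite /vanish => <-.
have [h Dh] := phi_dvd _ vanM.
have lead_unit : (lead_coef phi : int) \is a GRing.unit.
  have := congr1 lead_coef Dh; rewrite lead_coefM (monicP (monic_Xn_sub_1 _ M_gt0)).
  by move=> E; apply/unitrPr; exists (lead_coef h).
have sz_phi : size (map_poly intr phi : {poly K}) = size phi.
  apply: size_map_poly_id0; apply/eqP=> /= E.
  have : intr (lead_coef phi) \is a @GRing.unit K by apply: rmorph_unit.
  by rewrite E unitr0.
have /closed_rootP[z /rootP z_root] : size (map_poly intr phi : {poly K}) != 1%N.
  rewrite sz_phi; apply/negP=> /size_poly1P[a a_neq0 Dphi].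
  move: van_phi; rewrite /vanish Dphi map_polyC hornerC /= intr_eq0.
  by rewrite (negPf a_neq0).
exists z => f vanf; have [k ->] := phi_dvd f (introT eqP vanf).
by rewrite rmorphM /= hornerM z_root mul0r.
Qed.

Section Reduction.
Variables (C K : fieldType) (zeta : C) (z : K).
Hypothesis compat : forall f : {poly int},
  (map_poly intr f).[zeta] = 0 -> (map_poly intr f).[z] = 0.

(** The graph of the reduction map from Z[zeta] to K. *)
Definition reduces_to (x : C) (y : K) : Prop :=
  exists f : {poly int}, x = (map_poly intr f).[zeta] /\ y = (map_poly intr f).[z].

Lemma reduces_to1 : reduces_to 1 1.
Proof. by exists 1; rewrite !rmorph1 !hornerC. Qed.
Lemma reduces_to0 : reduces_to 0 0.
Proof. by exists 0; rewrite !rmorph0 !hornerC. Qed.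
Lemma reduces_to_gen : reduces_to zeta z.
Proof. by exists 'X; rewrite !map_polyX !hornerX. Qed.
Lemma reduces_toM x y x' y' : reduces_to x y -> reduces_to x' y' ->
  reduces_to (x * x') (y * y').
Proof. by case=> f [-> ->] [g [-> ->]]; exists (f * g); rewrite !rmorphM /= !hornerM. Qed.
Lemma reduces_toD x y x' y' : reduces_to x y -> reduces_to x' y' ->
  reduces_to (x + x') (y + y').
Proof. by case=> f [-> ->] [g [-> ->]]; exists (f + g); rewrite !rmorphD /= !hornerD. Qed.
Lemma reduces_toN x y : reduces_to x y -> reduces_to (- x) (- y).
Proof. by case=> f [-> ->]; exists (- f); rewrite !rmorphN /= !hornerN. Qed.
Lemma reduces_toX x y n : reduces_to x y -> reduces_to (x ^+ n) (y ^+ n).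
Proof. by case=> f [-> ->]; exists (f ^+ n); rewrite !rmorphXn /= !horner_exp. Qed.

Lemma reduces_to_sum (I : finType) (P : pred I) (x : I -> C) (y : I -> K) :
  (forall i, P i -> reduces_to (x i) (y i)) ->
  reduces_to (\sum_(i | P i) x i) (\sum_(i | P i) y i).
Proof.
move=> xy; apply: (big_rec2 reduces_to reduces_to0) => i y' x' Pi.
by apply: reduces_toD; apply: xy.
Qed.


Lemma reduces_to_0 y : reduces_to 0 y -> y = 0.
Proof. by case=> f [/esym/compat E ->]. Qed.

Lemma reduces_to_inj x y y' : reduces_to x y -> reduces_to x y' -> y = y'.
Proof.
move=> xy xy'; have := reduces_toD xy (reduces_toN xy').
by rewrite subrr => /reduces_to_0/subr0_eq.
Qed.

(** The units of the localization of Z[zeta] at the kernel of the reduction. *)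
Definition reduction_unit (u : C) : Prop :=
  exists x y x' y', [/\ reduces_to x y, reduces_to x' y', y != 0, y' != 0 & u * x' = x].

Lemma reduces_to_unit x y : reduces_to x y -> y != 0 -> reduction_unit x.
Proof.
by move=> xy y_neq0; exists x, y, 1, 1; rewrite mulr1 oner_neq0; split=> //; apply: reduces_to1.
Qed.

Lemma reduction_unit1 : reduction_unit 1.
Proof. exact: (reduces_to_unit reduces_to1 (oner_neq0 _)). Qed.

Lemma reduces_to_neq0 x y : reduces_to x y -> y != 0 -> x != 0.
Proof. by move=> xy; apply: contra_neq => x0; rewrite x0 in xy; apply: reduces_to_0. Qed.

Lemma reduction_unit_neq0 u : reduction_unit u -> u != 0.
Proof.
case=> x [y [x' [y' [xy _ y_neq0 _ Dx]]]].
by apply: contra_neq (reduces_to_neq0 xy y_neq0) => u0; rewrite -Dx u0 mul0r.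
Qed.

Lemma reduction_unitM u v : reduction_unit u -> reduction_unit v -> reduction_unit (u * v).
Proof.
case=> x [y [x' [y' [xy xy' y0 y0' Dx]]]] [t [s [t' [s' [ts ts' s0 s0' Dt]]]]].
exists (x * t), (y * s), (x' * t'), (y' * s'); rewrite !mulf_neq0 //.
by split=> //; try apply: reduces_toM => //; rewrite mulrACA Dx Dt.
Qed.

Lemma reduction_unitV u : reduction_unit u -> reduction_unit u^-1.
Proof.
move=> uU; have u0 := reduction_unit_neq0 uU.
case: uU => x [y [x' [y' [xy xy' y0 y0' Dx]]]].
by exists x', y', x, y; split=> //; rewrite -Dx mulKf.
Qed.

Lemma reduction_unitN u : reduction_unit u -> reduction_unit (- u).
Proof.
move=> uU; rewrite -mulN1r; apply: reduction_unitM => //.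
by apply: reduces_to_unit (reduces_toN reduces_to1) _; rewrite oppr_eq0 oner_neq0.
Qed.

Lemma reduction_unit_prod (I : finType) (u : I -> C) :
  (forall i, reduction_unit (u i)) -> reduction_unit (\prod_i u i).
Proof. by move=> uU; apply: big_ind => //; [apply: reduction_unit1 | apply: reduction_unitM]. Qed.

(** A nonzero w in the maximal ideal has powers that are pairwise not associate.
    If w = 0, the nonvanishing of the common value forces both exponents to be 0. *)
Lemma reduction_unit_exp_inj u v w m n :
    reduction_unit u -> reduction_unit v -> reduces_to w 0 ->
  u * w ^+ m = v * w ^+ n -> u * w ^+ m != 0 -> m = n.
Proof.
wlog le_mn : u v m n / (m <= n)%N => [IH|].
  have [le_mn|/ltnW le_nm] := leqP m n; first exact: IH.
  by move=> uU vU w0 E nz; apply/esym; apply: (IH v u) => //; rewrite -E.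
rewrite -(subnK le_mn) => uU vU w0; rewrite exprD mulrA => E nz.
have wm0 : w ^+ m != 0 by apply: contra_neq nz => ->; rewrite mulr0.
have {E} := mulIf wm0 E; case: (n - m)%N => // l Euv.
have : reduction_unit (w ^+ l.+1).
  have -> : w ^+ l.+1 = v^-1 * u by rewrite Euv mulKf // reduction_unit_neq0.
  exact/reduction_unitM/uU/reduction_unitV.
case=> x [y [x' [y' [xy xy' y0 _ Dx]]]].
have := reduces_toM (reduces_toX l.+1 w0) xy'; rewrite Dx => /(reduces_to_inj xy) y_eq0.
by rewrite y_eq0 expr0n mul0r eqxx in y0.
Qed.

End Reduction.

(** * Power sums and Jacobi sums over a finite field *)

Section PowerSums.
Variable E : finFieldType.
Local Notation Q := #|E|.

Lemma card_finField_gt1 : (1 < Q)%N. Proof. exact: finNzRing_gt1. Qed.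

Lemma expf_card_pred (x : E) : x != 0 -> x ^+ Q.-1 = 1.
Proof.
move=> x_neq0; apply: (mulfI x_neq0); rewrite -exprS prednK ?mulr1 ?expf_card //.
exact: ltnW card_finField_gt1.
Qed.

Lemma finField_prim_root : exists gamma : E, Q.-1.-primitive_root gamma.
Proof.
have Q1_gt0 : (0 < Q.-1)%N by rewrite -subn1 subn_gt0 card_finField_gt1.
have := @has_prim_root E Q.-1 (enum (predC1 (0 : E))) Q1_gt0.
rewrite enum_uniq -cardE; case/(_ _ isT _)/hasP => [||gamma _ prim_gamma]; last by exists gamma.
  by apply/allP=> x; rewrite mem_enum => /expf_card_pred xQ; apply/unity_rootP.
by rewrite cardC1.
Qed.

Lemma finField_card_pchar : exists p D,
  [/\ prime p, p \in [pchar E], (0 < D)%N & Q = (p ^ D)%N].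
Proof.
have [p pr_p pcharEp] := finPcharP E; exists p.
have := abelem_pgroup (fin_ring_pchar_abelem pcharEp).
rewrite /pgroup cardsT => /p_natP[D DQ]; exists D; split=> //.
by have := card_finField_gt1; rewrite DQ; case: (D).
Qed.

Lemma card_finField_eq0 : Q%:R = 0 :> E.
Proof.
have [p [D [_ pcharEp D_gt0 ->]]] := finField_card_pchar.
by rewrite natrX (pcharf0 pcharEp) expr0n gtn_eqF.
Qed.

Lemma power_sum_eq0 i : (i < Q.-1)%N -> \sum_(x : E) x ^+ i = 0.
Proof.
case: i => [_|i lt_i].
  by rewrite (eq_bigr (fun _ => 1)) // sumr_const card_finField_eq0.
have [gamma prim_gamma] := finField_prim_root.
have gamma_neq0 : gamma != 0.
  by rewrite (prim_root_eq0 prim_gamma) -lt0n (leq_ltn_trans _ lt_i).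
apply: (mulfI (_ : gamma ^+ i.+1 - 1 != 0)).
  by rewrite subr_eq0 -(prim_order_dvd prim_gamma) gtnNdvd.
rewrite mulr0 mulrBl mul1r big_distrr /= [X in _ - X](reindex_inj (mulfI gamma_neq0)) /=.
by rewrite -sumrB big1 // => x _; rewrite exprMn subrr.
Qed.

(** With y = 1/x the summand is y^{a+1} / (y - 1), which for y <> 1 is
    1 + y + ... + y^a + 1 / (y - 1).  The power sums of exponents 0, ..., a and
    the sum of the inverses vanish, so only the missing terms y^i at y = 1 are left:
    there are a + 1 of them. *)
Lemma jacobi_power_sum a : (0 < a)%N -> (a.+1 < Q.-1)%N ->
  \sum_(x : E) x^-1 ^+ a * (1 - x)^-1 = - a.+1%:R.
Proof.
move=> a_gt0 lt_a; rewrite (reindex_inj invr_inj) /=.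
have geom (y : E) : y^-1^-1 ^+ a * (1 - y^-1)^-1
    = \sum_(i < a.+1) y ^+ i - (y == 1)%:R * a.+1%:R + (y - 1)^-1.
  have [->|y_neq1] := eqVneq y 1.
    rewrite invr1 subrr invr0 mulr0 mul1r addr0.
    rewrite (eq_bigr (fun _ => 1)) => [|i _]; last by rewrite expr1n.
    by rewrite sumr_const card_ord subrr.
  rewrite mul0r subr0 invrK.
  have y1_neq0 : y - 1 != 0 by rewrite subr_eq0.
  apply: (mulfI y1_neq0); rewrite mulrDr -subrX1 mulfV // subrK.
  have [->|y_neq0] := eqVneq y 0.
    by rewrite !expr0n gtn_eqF //= mul0r mulr0.
  have -> : 1 - y^-1 = (y - 1) / y by rewrite mulrBl mulfV // mul1r.
  by rewrite invf_div mulrCA [_ * (y / _)]mulrCA mulfV // mulr1 -exprSr.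
rewrite (eq_bigr _ (fun y _ => geom y)) !big_split /= exchange_big /= big1; last first.
  by move=> i _; apply: power_sum_eq0; rewrite (leq_trans (ltn_ord i)) // ltnW.
rewrite add0r [X in _ + X](_ : _ = 0) ?addr0; last first.
  rewrite (reindex_inj (addIr 1)) /=.
  under eq_bigr do rewrite addrK.
  rewrite (reindex_inj invr_inj) /= (eq_bigr (fun u => u ^+ 1)) => [|u _].
    by apply: power_sum_eq0; rewrite (leq_ltn_trans _ lt_a).
  by rewrite invrK expr1.
by rewrite sumrN (bigD1 1) //= eqxx mul1r big1 ?addr0 // => y /negPf->; rewrite mul0r.
Qed.

End PowerSums.

Section MulcharPowers.
Variables (E : finFieldType) (C : fieldType).
Implicit Types (chi : mulchar E C) (x y : E).

Lemma mulcharXE chi a x : x != 0 -> (chi ^+ a)%g x = chi x ^+ a.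
Proof.
move=> x_neq0; elim: a => [|a IHa]; first by rewrite expg0 mulchar1gE x_neq0.
by rewrite expgS mulcharMgE IHa exprS.
Qed.

Lemma mulcharX_pos chi a x : (0 < a)%N -> (chi ^+ a)%g x = chi x ^+ a.
Proof.
move=> a_gt0; have [->|] := eqVneq x 0; last exact: mulcharXE.
by rewrite !mulchar0 expr0n gtn_eqF.
Qed.

Lemma mulchar_exp chi a x : chi (x ^+ a) = chi x ^+ a.
Proof.
by elim: a => [|a IHa]; rewrite ?expr0 ?mulchar1 // !exprS mulcharM IHa.
Qed.

Lemma mulchar_torsion chi : (chi ^+ #|E|.-1)%g = 1%g.
Proof.
apply: mulchar_inj => x; rewrite mulchar1gE.
have [->|x_neq0] := eqVneq x 0; first by rewrite mulchar0.
by rewrite mulcharXE // -mulchar_exp expf_card_pred ?mulchar1.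
Qed.

Lemma mulchar_sum0 chi : chi <> 1%g -> \sum_x chi x = 0.
Proof.
move=> chi_neq1; have [y y_neq0 chiy] : exists2 y, y != 0 & chi y != 1.
  apply: contra_notP chi_neq1 => no_y; apply: mulchar_inj => x; rewrite mulchar1gE.
  have [->|x_neq0] := eqVneq x 0; first exact: mulchar0.
  by apply/eqP; apply: contra_notT no_y => chix; exists x.
apply: (mulfI (_ : chi y - 1 != 0)); first by rewrite subr_eq0.
rewrite mulr0 mulrBl mul1r big_distrr /= [X in _ - X](reindex_inj (mulfI y_neq0)) /=.
by rewrite -sumrB big1 // => x _; rewrite mulcharM subrr.
Qed.

End MulcharPowers.

Section GaussJacobi.
Variables (E : finFieldType) (C : fieldType) (psi : E -> C).
Hypothesis psiD : forall x y, psi (x + y) = psi x * psi y.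
Implicit Types (chi : mulchar E C).
Local Notation g chi := (gauss_sum chi psi).

Lemma gauss_sumE chi : g chi = \sum_x chi x * psi x.
Proof.
rewrite [RHS](bigID (fun x => x != 0)) /= [X in _ + X]big1 ?addr0 //.
by move=> x /negbNE/eqP->; rewrite mulchar0 mul0r.
Qed.

Definition jacobi_sum (chi1 chi2 : mulchar E C) : C := \sum_x chi1 x * chi2 (1 - x).

(** Collect the terms of the double sum according to t = x + y: the substitution
    x = t u gives the Jacobi sum for t <> 0, and for t = 0 the inner sum is the
    sum of the values of a nontrivial character. *)
Lemma gauss_jacobi chi1 chi2 : (chi1 * chi2)%g <> 1%g ->
  g chi1 * g chi2 = jacobi_sum chi1 chi2 * g (chi1 * chi2)%g.
Proof.
move=> chi12; rewrite !gauss_sumE big_distrlr /=.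
under eq_bigr => x _.
  rewrite (reindex_inj (addIr (- x))) /=.
  under eq_bigr => t _ do rewrite mulrACA -psiD addrCA subrr addr0.
  over.
rewrite exchange_big /= big_distrr /=; apply: eq_bigr => t _.
rewrite -big_distrl /= mulrA; congr (_ * _).
have [->|t_neq0] := eqVneq t 0.
  rewrite (mulchar0 (chi1 * chi2)%g) mulr0.
  transitivity (chi2 (-1) * \sum_x (chi1 * chi2)%g x); last by rewrite mulchar_sum0 ?mulr0.
  rewrite big_distrr /=.
  apply: eq_bigr => x _; rewrite sub0r -[- x]mulN1r mulcharM mulcharMgE.
  by rewrite mulrCA.
rewrite (reindex_inj (mulfI t_neq0)) /= big_distrl; apply: eq_bigr => x _ /=.
have -> : t - t * x = t * (1 - x) by rewrite mulrBr mulr1.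
by rewrite !mulcharM ffunE mulrACA mulrC.
Qed.

End GaussJacobi.

(** * The divisibility of Gauss sums by a prime above p *)

Section AdditiveCharacters.
Variables (E : finFieldType) (C : fieldType).
Implicit Types psi phi : E -> C.

Definition additive_char psi : Prop :=
  (forall x y, psi (x + y) = psi x * psi y) /\ (forall x, psi x != 0).

Lemma additive_char0 psi : additive_char psi -> psi 0 = 1.
Proof.
case=> psiD psi_neq0; apply: (mulfI (psi_neq0 0)).
by rewrite -psiD addr0 mulr1.
Qed.

Lemma additive_charMn psi x n : additive_char psi -> psi (x *+ n) = psi x ^+ n.
Proof.
move=> psiP; elim: n => [|n IHn]; first by rewrite mulr0n expr0 additive_char0.
by rewrite mulrS exprS -IHn; case: psiP.
Qed.

Lemma additive_char_sum0 psi y : additive_char psi -> psi y != 1 -> \sum_x psi x = 0.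
Proof.
case=> psiD _ psiy; apply: (mulfI (_ : psi y - 1 != 0)); first by rewrite subr_eq0.
rewrite mulr0 mulrBl mul1r big_distrr /= [X in _ - X](reindex_inj (addrI y)) /=.
by rewrite -sumrB big1 // => x _; rewrite psiD subrr.
Qed.

(** Summing phi(x) psi(-bx) over all b and x gives the order of E, so for some b
    the sum over x is nonzero; the additive character that it sums must then be
    trivial. *)
Lemma additive_char_dual psi phi y :
    #|E|%:R != 0 :> C -> additive_char psi -> additive_char phi -> psi y != 1 ->
  exists b, forall x, phi x = psi (b * x).
Proof.
move=> Q_neq0 psiP phiP psiy; have [psiD psi_neq0] := psiP; have [phiD phi_neq0] := phiP.
pose theta b x := phi x * psi (- (b * x)).
have thetaP b : additive_char (theta b).
  split=> [x x'|x]; last by rewrite mulf_neq0.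
  by rewrite /theta phiD mulrDr opprD psiD mulrACA.
have sum_theta : \sum_b \sum_x theta b x = #|E|%:R.
  rewrite exchange_big /= (bigD1 0) //= [X in _ + X]big1 ?addr0 => [|x x_neq0].
    rewrite (eq_bigr (fun _ => 1)) ?sumr_const // => b _.
    by rewrite /theta mulr0 oppr0 !additive_char0 ?mulr1.
  rewrite -big_distrr /= (reindex_inj (mulIf (invr_neq0 x_neq0))) /=.
  under eq_bigr do rewrite mulfVK //.
  by rewrite (reindex_inj oppr_inj) /=; under eq_bigr do rewrite opprK;
     rewrite (additive_char_sum0 psiP psiy) mulr0.
have [b sum_b] : exists b, \sum_x theta b x <> 0.
  apply: contrapT => no_b; move/eqP: Q_neq0; apply; rewrite -sum_theta big1 // => b _.
  by apply: contrapT => ?; apply: no_b; exists b.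
exists b => x; apply: contra_notP sum_b => ne_x; apply: (@additive_char_sum0 _ x) => //.
apply: contra_not_neq ne_x => thetax.
by apply: (mulIf (psi_neq0 (- (b * x)))); rewrite -psiD subrr additive_char0.
Qed.

(** The character psi need not be invariant under the p-power map when it comes
    from a proper extension of the prime field; it becomes a rescaling of psi,
    which changes Gauss sums by a root of unity only. *)
Lemma additive_char_pfrobenius psi p :
    #|E|%:R != 0 :> C -> p \in [pchar E] -> additive_char psi ->
  exists2 b, b != 0 & forall x, psi (x ^+ p) = psi (b * x).
Proof.
move=> Q_neq0 pcharE psiP; have [psiD psi_neq0] := psiP.
have [[y psiy]|psi1] := pselect (exists y, psi y != 1); last first.
  have {}psi1 x : psi x = 1 by apply: contra_notP psi1 => /eqP psix; exists x.
  by exists 1 => [|x]; rewrite ?oner_neq0 ?psi1.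
have phiP : additive_char (fun x => psi (x ^+ p)).
  split=> // x x'; rewrite -psiD; congr psi.
  exact: (rmorphD (pFrobenius_aut pcharE)).
have [b Db] := additive_char_dual Q_neq0 psiP phiP psiy.
exists b => //; apply: contra_neq psiy => b0.
have [x <-] : exists x, x ^+ p = y.
  have [g' _ gK] := injF_bij (fmorph_inj (pFrobenius_aut pcharE)).
  by exists (g' y); have := gK y.
by rewrite Db b0 mul0r additive_char0.
Qed.

End AdditiveCharacters.

Section Stickelberger.
Variables (E : finFieldType) (C K : fieldType) (sigma : {rmorphism E -> K}).
Variables (p : nat) (zeta : C) (z : K).
Local Notation Q := #|E|.
Hypotheses (pcharE : p \in [pchar E]) (pcharC : [pchar C] =i pred0) (Q_gt2 : (2 < Q)%N).
Hypothesis prim_zeta : (p * Q.-1).-primitive_root zeta.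
Hypothesis compat : forall f : {poly int},
  (map_poly intr f).[zeta] = 0 -> (map_poly intr f).[z] = 0.

Local Notation reduces := (reduces_to zeta z).
Local Notation runit := (reduction_unit zeta z).

Let p_prime : prime p. Proof. exact: pcharf_prime pcharE. Qed.
Let pcharK : p \in [pchar K]. Proof. by rewrite (fmorph_pchar sigma). Qed.
Let Q1_gt0 : (0 < Q.-1)%N. Proof. by case: (Q) Q_gt2 => [|[]]. Qed.
Let zeta0 := zeta ^+ p.
Let z0 := z ^+ p.

Let prim_zeta0 : Q.-1.-primitive_root zeta0.
Proof.
have := dvdn_prim_root prim_zeta (dvdn_mull p (dvdnn Q.-1)).
by rewrite mulnK.
Qed.

Let reduces_zeta0 : reduces zeta0 z0.
Proof. exact/reduces_toX/reduces_to_gen. Qed.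

Let card_K : Q%:R = 0 :> K.
Proof. by rewrite -(rmorph_nat sigma) card_finField_eq0 rmorph0. Qed.

Let cardP_K : (Q.-1)%:R = -1 :> K.
Proof. by apply/eqP; rewrite -addr_eq0 natr1 prednK ?card_K // ltnW // ltnW. Qed.

(** Reduction is injective on roots of unity of order prime to p: if zeta0^m <> 1
    then its powers add up to 0, while they would add up to Q - 1 = -1 in K if
    z0^m were 1. *)
Let prim_z0 : Q.-1.-primitive_root z0.
Proof.
have z0Q : z0 ^+ Q.-1 = 1.
  apply: (reduces_to_inj compat (reduces_toX Q.-1 reduces_zeta0)).
  rewrite (prim_expr_order prim_zeta0); exact: reduces_to1.
have [m prim_m m_dvd] := prim_order_exists Q1_gt0 z0Q.
suff -> : Q.-1 = m by [].
apply/eqP; rewrite eqn_dvd m_dvd andbT (prim_order_dvd prim_zeta0).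
apply: contraT => zm_neq1; pose x := zeta0 ^+ m.
have sum_x : \sum_(j < Q.-1) x ^+ j = 0.
  apply: (mulfI (_ : x - 1 != 0)); first by rewrite subr_eq0.
  by rewrite -subrX1 mulr0 /x exprAC (prim_expr_order prim_zeta0) expr1n subrr.
have : reduces 0 (\sum_(j < Q.-1) 1).
  rewrite -sum_x; apply: reduces_to_sum => j _.
  have -> : 1 = (z0 ^+ m) ^+ j by rewrite (prim_expr_order prim_m) expr1n.
  exact/reduces_toX/reduces_toX.
rewrite sumr_const card_ord => /(reduces_to_0 compat)/eqP.
by rewrite cardP_K oppr_eq0 oner_eq0.
Qed.

(** Both E^* and the group generated by zeta0 are cyclic of order Q - 1, and the
    reduction identifies the second group with the image of the first one. *)
Lemma teichmuller_exists : exists tau : mulchar E C,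
  [/\ forall x, reduces (tau x) (sigma x)^-1,
      forall chi : mulchar E C, exists2 a, (a < Q.-1)%N & chi = (tau ^+ a)%g
    & forall a, (tau ^+ a)%g = 1%g -> (Q.-1 %| a)%N].
Proof.
have [gamma prim_gamma] := finField_prim_root E.
have prim_sg : Q.-1.-primitive_root (sigma gamma) by rewrite fmorph_primitive_root.
have [i Di] := prim_rootP prim_sg (prim_expr_order prim_z0).
pose g := gamma ^+ i.
have sg : sigma g = z0 by rewrite rmorphXn -Di.
have prim_g : Q.-1.-primitive_root g by rewrite -(fmorph_primitive_root sigma) sg.
have logP x : exists a : 'I_Q.-1, (x != 0) ==> (x == g ^+ a).
  have [->|x_neq0] /= := eqVneq x 0; first by exists (Ordinal Q1_gt0).
  by have [a ->] := prim_rootP prim_g (expf_card_pred x_neq0); exists a.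
pose lg x := xchoose (logP x).
have lgP x : x != 0 -> x = g ^+ lg x.
  by move=> x_neq0; exact: (eqP (implyP (xchooseP (logP x)) x_neq0)).
pose t := [ffun x => if x == 0 then 0 else (zeta0 ^+ lg x)^-1].
have g_neq0 : g != 0 by rewrite (prim_root_eq0 prim_g) -lt0n.
have tE a : t (g ^+ a) = (zeta0 ^+ a)^-1.
  rewrite ffunE expf_eq0 (negPf g_neq0) andbF; congr (_^-1).
  apply/eqP; rewrite (eq_prim_root_expr prim_zeta0) -(eq_prim_root_expr prim_g).
  by rewrite -lgP // expf_neq0.
have t0 : t 0 = 0 by rewrite ffunE eqxx.
have tP : is_mulchar t.
  apply/mulcharP; split=> // [|x y]; first by have := tE 0%N; rewrite !expr0 invr1.
  have [->|x_neq0] := eqVneq x 0; first by rewrite mul0r t0 mul0r.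
  have [->|y_neq0] := eqVneq y 0; first by rewrite mulr0 t0 mulr0.
  by rewrite (lgP _ x_neq0) (lgP _ y_neq0) -exprD !tE exprD invfM.
exists (MulChar tP); split=> [x|chi|a].
- have [->|x_neq0] := eqVneq x 0; first by rewrite mulchar0 rmorph0 invr0; exact: reduces_to0.
  rewrite (lgP _ x_neq0) /= tE rmorphXn sg.
  have lt_lg := ltn_ord (lg x).
  have inv_exp (F' : fieldType) (y : F') : Q.-1.-primitive_root y ->
      (y ^+ lg x)^-1 = y ^+ (Q.-1 - lg x).
    move=> prim_y; have y_neq0 : y != 0 by rewrite (prim_root_eq0 prim_y) -lt0n.
    apply: (mulfI (expf_neq0 (lg x) y_neq0)).
    by rewrite mulfV ?expf_neq0 // -exprD subnKC ?(ltnW lt_lg) // (prim_expr_order prim_y).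
  by rewrite !inv_exp //; apply: reduces_toX.
- have chig : chi g ^+ Q.-1 = 1.
    by rewrite -mulchar_exp (prim_expr_order prim_g) mulchar1.
  have [a Da] : {a : 'I_Q.-1 | (chi g)^-1 = zeta0 ^+ a}.
    by apply: (prim_rootP prim_zeta0); rewrite exprVn chig invr1.
  exists a => //; apply: mulchar_inj => x.
  have [->|x_neq0] := eqVneq x 0; first by rewrite !mulchar0.
  rewrite mulcharXE // (lgP _ x_neq0) mulchar_exp /= tE -exprVn exprAC; congr (_ ^+ _).
  by rewrite exprVn -Da invrK.
- move=> /(congr1 (fun chi : mulchar E C => chi g)); rewrite mulcharXE // mulchar1gE g_neq0 /=.
  have := tE 1%N; rewrite !expr1 => -> /eqP.
  by rewrite exprVn invr_eq1 -(prim_order_dvd prim_zeta0).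
Qed.

Variable tau : mulchar E C.
Hypothesis tau_reduces : forall x, reduces (tau x) (sigma x)^-1.
Hypothesis tau_order : forall a, (tau ^+ a)%g = 1%g -> (Q.-1 %| a)%N.

Variable psi : E -> C.
Hypothesis psiP : additive_char psi.
Let psiD : forall x y, psi (x + y) = psi x * psi y. Proof. by case: psiP. Qed.

Local Notation G a := (gauss_sum (tau ^+ a)%g psi).

Lemma mulchar_runit chi x : x != 0 -> (exists a, chi = tau ^+ a)%g -> runit (chi x).
Proof.
move=> x_neq0 [a ->]; rewrite mulcharXE //.
apply: (reduces_to_unit (reduces_toX a (tau_reduces x))).
by rewrite expf_neq0 // invr_neq0 // fmorph_eq0.
Qed.

Lemma additive_char_reduces x : reduces (psi x) 1.
Proof.
have psixp : psi x ^+ p = 1.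
  by rewrite -additive_charMn // -mulr_natl (pcharf0 pcharE) mul0r additive_char0.
have := dvdn_prim_root prim_zeta (dvdn_mulr Q.-1 (dvdnn p)).
rewrite mulKn ?prime_gt0 // => prim_zp.
have [i ->] := prim_rootP prim_zp psixp.
have zQ : z ^+ Q.-1 = 1.
  apply: (fmorph_inj (pFrobenius_aut pcharK)); rewrite rmorph1 /= pFrobenius_autE.
  by rewrite exprAC (prim_expr_order prim_z0).
rewrite -(expr1n _ i); apply: reduces_toX; rewrite -zQ.
exact/reduces_toX/reduces_to_gen.
Qed.

Lemma gauss_sum_reduces : reduces (G 1) 0.
Proof.
have <- : sigma (\sum_x x^-1) = 0.
  rewrite (reindex_inj invr_inj) /= (eq_bigr (fun u => u ^+ 1)) => [|u _].
    by rewrite power_sum_eq0 ?rmorph0 //; case: (Q) Q_gt2 => [|[]].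
  by rewrite invrK expr1.
rewrite gauss_sumE rmorph_sum; apply: reduces_to_sum => x _.
rewrite -[sigma _]mulr1 fmorphV; apply: reduces_toM; last exact: additive_char_reduces.
by rewrite expg1.
Qed.

Lemma gauss_sum0_unit : runit (G 0).
Proof.
have red : reduces (G 0) (\sum_(x : E | x != 0) 1).
  apply: reduces_to_sum => x x_neq0; rewrite expg0 mulchar1gE x_neq0 mul1r.
  exact: additive_char_reduces.
apply: (reduces_to_unit red).
have -> : \sum_(x : E | x != 0) 1 = Q.-1%:R :> K.
  by rewrite sumr_const cardC1.
by rewrite cardP_K oppr_eq0 oner_eq0.
Qed.

(** Substitute x^p for x, and absorb the resulting rescaling of psi. *)
Lemma gauss_sum_pfrobenius a : exists2 u, runit u & G a = u * G (p * a).
Proof.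
have Q_neq0 : Q%:R != 0 :> C.
  by move/pcharf0P: pcharC => ->; rewrite -lt0n ltnW // ltnW.
have [b b_neq0 Db] := additive_char_pfrobenius Q_neq0 pcharE psiP.
exists ((tau ^+ (p * a))%g b^-1).
  by apply: mulchar_runit; [rewrite invr_neq0 | exists (p * a)%N].
rewrite !gauss_sumE (reindex_inj (fmorph_inj (pFrobenius_aut pcharE))) /=.
rewrite big_distrr /= [RHS](reindex_inj (mulfI b_neq0)) /=; apply: eq_bigr => x _.
rewrite pFrobenius_autE Db mulrA; congr (_ * _).
rewrite -mulcharM mulKf // mulnC expgM; have [->|x_neq0] := eqVneq x 0.
  by rewrite expr0n gtn_eqF ?prime_gt0 // !mulchar0.
by rewrite [in RHS]mulcharXE // mulchar_exp.
Qed.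

Lemma jacobi_sum_reduces a : (0 < a)%N -> (a.+1 < Q.-1)%N ->
  reduces (jacobi_sum (tau ^+ a)%g tau) (- a.+1%:R).
Proof.
move=> a_gt0 lt_a; rewrite -(rmorph_nat sigma) -rmorphN -jacobi_power_sum // rmorph_sum.
apply: reduces_to_sum => x _; rewrite rmorphM rmorphXn !fmorphV.
by apply: reduces_toM => //; rewrite mulcharX_pos //; apply: reduces_toX.
Qed.

(** Induction on a along its base-p digits.  If p divides a, the Frobenius
    relation removes a digit 0; otherwise the last digit is decreased by one at the
    cost of a factor w and a Jacobi sum which reduces to -a, a unit. *)
Theorem stickelberger a : (a < Q.-1)%N ->
  exists2 u, runit u & G a = u * G 1 ^+ digit_sum p a.
Proof.
elim/ltn_ind: a => a IHa lt_a; have p_gt1 := prime_gt1 p_prime.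
have [->|a_gt0] := posnP a.
  exists (G 0); first exact: gauss_sum0_unit.
  by rewrite digit_sum0 expr0 mulr1.
have [/dvdnP[b Da]|p_ndvd] := boolP (p %| a)%N.
  rewrite mulnC in Da; have lt_ba : (b < a)%N.
    by rewrite Da ltn_Pmull //; case: (b) Da a_gt0 => // ->; rewrite muln0.
  have [v vU Dv] := IHa b lt_ba (ltn_trans lt_ba lt_a).
  have [u uU Du] := gauss_sum_pfrobenius b.
  exists (u^-1 * v); first exact/(reduction_unitM _ vU)/(reduction_unitV compat).
  rewrite Da digit_sumM // -mulrA -Dv Du mulKf //.
  exact: (reduction_unit_neq0 compat).
case: a => // a in IHa lt_a a_gt0 p_ndvd *; rewrite digit_sumS //.
have [->|{}a_gt0] := posnP a.
  by exists 1; [apply: reduction_unit1 | rewrite digit_sum0 expr1 mul1r].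
have [v vU Dv] := IHa a (ltnSn a) (ltnW lt_a).
have JU : runit (jacobi_sum (tau ^+ a)%g tau).
  apply: (reduces_to_unit (jacobi_sum_reduces a_gt0 lt_a)).
  by rewrite oppr_eq0 -(dvdn_pcharf pcharK).
have tau_neq1 : (tau ^+ a * tau)%g <> 1%g.
  by rewrite -expgSr => /tau_order; rewrite gtnNdvd.
exists ((jacobi_sum (tau ^+ a)%g tau)^-1 * v).
  exact/(reduction_unitM _ vU)/(reduction_unitV compat).
rewrite exprSr mulrA -(mulrA _ v) -Dv; have := gauss_jacobi psiD tau_neq1.
rewrite -expgSr expg1 -mulrA => ->; rewrite mulKf //.
exact: (reduction_unit_neq0 compat).
Qed.

End Stickelberger.

(** * Twisting by the powers of the inverse Teichmueller character *)

Section MulcharGroup.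
Variables (E : finFieldType) (C : fieldType).
Implicit Types (chi mu : mulchar E C).

Lemma mulchar_mulgC chi mu : (chi * mu = mu * chi)%g.
Proof. exact: mulchar_mulC. Qed.

Lemma mulchar_expgM chi mu n : ((chi * mu) ^+ n = chi ^+ n * mu ^+ n)%g.
Proof. exact/expgMn/mulchar_mulgC. Qed.
End MulcharGroup.

Section TwistedExponents.
Variables (E : finFieldType) (C : fieldType) (tau : mulchar E C).
Variables (p h r : nat).
Local Notation B := (p ^ h)%N.
Local Notation T := (r.+1 + r.+2)%N.
Local Notation Q := #|E|.
Hypotheses (p_gt1 : (1 < p)%N) (h_gt0 : (0 < h)%N) (card_E : Q = (B ^ T)%N).
Hypothesis tau_gen : forall chi : mulchar E C, exists2 a, (a < Q.-1)%N & chi = (tau ^+ a)%g.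
Hypothesis tau_order : forall a, (tau ^+ a)%g = 1%g -> (Q.-1 %| a)%N.

Let B_gt1 : (1 < B)%N. Proof. by rewrite -(expn0 p) ltn_exp2l. Qed.
Let B_gt0 : (0 < B)%N. Proof. exact: ltnW. Qed.
Let B1_gt0 : (0 < B.-1)%N. Proof. by case: B B_gt1 => [|[]]. Qed.

(** The order Q - 1 of tau is (B - 1) R, so the exponents of the characters killed
    by B - 1 are the multiples of R. *)
Lemma torsion_exponent kappa : (kappa ^+ B.-1)%g = 1%g ->
  exists2 eps, (eps < B.-1)%N &
    kappa = (tau ^+ (eps * repunit B T))%g /\ (kappa == 1%g) = (eps == 0).
Proof.
move=> kappaB; have [a lt_a Dkappa] := tau_gen kappa.
have DQ : Q.-1 = (repunit B T * B.-1)%N by rewrite card_E -repunitM // mulnC.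
have /dvdnP[eps Da] : (repunit B T %| a)%N.
  by rewrite -(dvdn_pmul2r B1_gt0) -DQ tau_order // expgM -Dkappa.
have lt_eps : (eps < B.-1)%N.
  rewrite Da DQ [X in (_ < X)%N]mulnC in lt_a; move: lt_a.
  by rewrite ltn_mul2r => /andP[].
exists eps => //; split; first by rewrite Dkappa Da.
apply/eqP/eqP=> [kappa1|eps0]; last by rewrite Dkappa Da eps0 mul0n expg0.
have := tau_order (etrans (esym Dkappa) kappa1).
have [a0|a_gt0] := posnP a; last by rewrite gtnNdvd.
have R_gt0 : (0 < repunit B T)%N by rewrite /repunit addSn big_ord_recl expn0.
by move=> _; case: (posnP eps) => // eps_gt0; move: Da; rewrite -(prednK eps_gt0) mulSn; lia.
Qed.

Definition twist (phi : mulchar E C) t : mulchar E C := (tau ^+ (B ^ t).-1 * phi^-1)%g.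

(** The excluded characters are killed by B - 1, whereas tau^{B^t - 1} is not,
    because (B^t - 1) (B - 1) < Q - 1. *)
Lemma twist_inv_neq phi mu t : (0 < t)%N -> (t < T)%N ->
  (phi ^+ B.-1 = 1)%g -> (mu ^+ B.-1 = 1)%g -> (twist phi t)^-1%g <> mu.
Proof.
move=> t_gt0 lt_tT phiB muB Dmu.
have Dtau : (tau ^+ (B ^ t).-1 = phi * mu^-1)%g.
  by rewrite -Dmu invgK mulchar_mulgC mulgVK.
have /tau_order : (tau ^+ ((B ^ t).-1 * B.-1) = 1)%g.
  by rewrite expgM Dtau mulchar_expgM phiB expVgn muB invg1 mulg1.
have Bt_gt1 : (1 < B ^ t)%N by rewrite -(expn0 B) ltn_exp2l.
rewrite gtnNdvd ?muln_gt0 ?B1_gt0 ?andbT //; first by case: (B ^ t)%N Bt_gt1 => [|[]].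
rewrite card_E; have : (B ^ t.+1 <= B ^ T)%N by rewrite leq_pexp2l.
rewrite expnS; nia.
Qed.

(** For negative n the character is the inverse of the one obtained from -n and
    mu^-1; its exponent is the complement to Q - 1, which accounts for
    the sign of n. *)
Lemma twisted_exponents phi mu n : (0 < `|n| <= B ^ r)%N ->
  (phi ^+ B.-1 = 1)%g -> (mu ^+ B.-1 = 1)%g ->
  exists e : nat * nat,
  [/\ (e.1 < Q.-1)%N /\ (e.2 < Q.-1)%N,
      (expgz (twist phi r.+1) n * mu = tau ^+ e.1)%g,
      (expgz (twist phi r.+2) n * mu = tau ^+ e.2)%g
    & (digit_sum p e.2)%:Z - (digit_sum p e.1)%:Z
        = sgz n *+ (expgz phi n == mu) * (h * p.-1)%:Z].
Proof.
move=> n_bnd phiB muB.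
(* The sign of n is dealt with by applying this to mu or to its inverse. *)
have main m mu' : (0 < m)%N -> (m <= B ^ r)%N -> (mu' ^+ B.-1 = 1)%g ->
    exists2 eps, (eps < B.-1)%N &
    ((phi ^+ m)%g == mu') = (eps == 0) /\
    forall t, (twist phi t ^+ m * mu' = tau ^+ block_exp p h r m eps t)%g.
  move=> m_gt0 m_le mu'B.
  have [|eps lt_eps [Deps eps0]] := @torsion_exponent (phi^-1 ^+ m * mu')%g.
    by rewrite mulchar_expgM mu'B mulg1 -expgM mulnC expgM expVgn phiB invg1 expg1n.
  exists eps => //; split=> [|t].
    by rewrite -eps0 expVgn -[RHS](inj_eq (mulgI (phi ^+ m)%g)) mulKVg mulg1 eq_sym.
  rewrite mulchar_expgM -mulgA Deps -expgM -expgD /block_exp.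
  by rewrite [(_.-1 * m)%N]mulnC.
have lt_exp m eps t : (0 < m)%N -> (m <= B ^ r)%N -> (eps < B.-1)%N -> (r < t <= r.+2)%N ->
    (block_exp p h r m eps t < Q.-1)%N /\ (0 < block_exp p h r m eps t)%N.
  move=> m_gt0 m_le lt_eps /andP[lt_rt le_t]; rewrite card_E.
  split; first exact: block_exp_lt.
  by apply: block_exp_gt0 => //; apply: leq_ltn_trans lt_rt.
case: n n_bnd => [m /andP[m_gt0 m_le]|m /andP[m_gt0 m_le]].
  have [eps lt_eps [Deps Dexp]] := main m mu m_gt0 m_le muB.
  exists (block_exp p h r m eps r.+1, block_exp p h r m eps r.+2) => /=.
  split; rewrite ?Dexp //.
    by split; apply: (proj1 (lt_exp _ _ _ _ _ _ _)) => //; rewrite ltnSn leqnSn ?ltnW.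
  rewrite digit_sum_block_exp // Deps gtr0_sgz ?ltz_nat // PoszD addrAC subrr add0r.
  by case: (eps == 0); rewrite ?mul0n ?mul1n ?mul1r ?mul0r.
have muVB : (mu^-1 ^+ B.-1 = 1)%g by rewrite expVgn muB invg1.
have [eps lt_eps [Deps Dexp]] := main m.+1 mu^-1%g m_gt0 m_le muVB.
pose v t := block_exp p h r m.+1 eps t.
have v1 : (v r.+1 < Q.-1 /\ 0 < v r.+1)%N by apply: lt_exp; rewrite // ltnSn ltnW.
have v2 : (v r.+2 < Q.-1 /\ 0 < v r.+2)%N by apply: lt_exp; rewrite // ltnSn ltnW.
exists (Q.-1 - v r.+1, Q.-1 - v r.+2)%N => /=.
have Q_gt0 : (0 < Q)%N by rewrite (leq_ltn_trans _ (finNzRing_gt1 E)).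
have neg t : (v t < Q.-1)%N -> ((twist phi t) ^- m.+1 * mu = tau ^+ (Q.-1 - v t))%g.
  move=> lt_v; apply: (mulgI (tau ^+ v t)%g); rewrite -expgD subnKC ?(ltnW lt_v) //.
  rewrite mulchar_torsion -Dexp [(_ ^- _ * mu)%g]mulchar_mulgC -mulgA mulKg.
  exact: mulgV.
have [v1_lt v1_gt0] := v1; have [v2_lt v2_gt0] := v2.
split; rewrite ?neg //.
  by rewrite !ltn_subrL v1_gt0 v2_gt0 (leq_ltn_trans _ v1_lt).
have compl t : (v t < Q.-1)%N -> (digit_sum p (Q.-1 - v t) + digit_sum p (v t) = h * T * p.-1)%N.
  have DQ : Q = (p ^ (h * T))%N by rewrite card_E expnM.
  by move=> lt_v; rewrite DQ digit_sum_compl // -DQ; lia.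
have := compl _ v1.1; have := compl _ v2.1.
rewrite {2}/v digit_sum_block_exp // -/(v _).
have -> : (expgz phi (Negz m) == mu) = (eps == 0).
  by rewrite -Deps /= -(inj_eq invg_inj) invgK.
rewrite NegzE sgzN gtr0_sgz //.
case: (eps == 0); rewrite /= ?mul0n ?mul1n; lia.
Qed.

End TwistedExponents.

(** * Relations between the exponents of a product of Gauss sums *)

(** The field-theoretic core: phi plays the role of xi and mu of the chi_i, both
    pulled back to E.  Evaluating the identity at two twists of phi^-1 gives two
    expressions of c as a unit times a power of w, and the exponents must agree. *)
Lemma gauss_product_relation (E : finFieldType) (C : numClosedFieldType)
    (K : closedFieldType) (sigma : {rmorphism E -> K}) (p h r : nat)
    (psi : E -> C) (k : nat) (phi : mulchar E C) (mu : 'I_k -> mulchar E C)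
    (n : 'I_k -> int) (c : C) (a : E) :
  p \in [pchar E] -> (0 < h)%N -> #|E| = ((p ^ h) ^ (r.+1 + r.+2))%N ->
  additive_char psi ->
  (phi ^+ (p ^ h).-1 = 1)%g -> (forall i, (mu i ^+ (p ^ h).-1 = 1)%g) ->
  (forall i, (0 < `|n i| <= (p ^ h) ^ r)%N) -> c != 0 -> a != 0 ->
  (forall lambda : mulchar E C, (forall i, (lambda^-1)%g <> mu i) ->
     \prod_(i < k) (- gauss_sum (expgz lambda (n i) * mu i)%g psi) = c * lambda a) ->
  \sum_(i < k) sgz (n i) *+ (expgz phi (n i) == mu i) = 0.
Proof.
move=> pcharE h_gt0 card_E psiP phiB muB n_bnd c_neq0 a_neq0 ident.
have p_gt1 : (1 < p)%N := prime_gt1 (pcharf_prime pcharE).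
have Q_gt2 : (2 < #|E|)%N.
  rewrite card_E -expnM; apply: (@leq_trans (2 ^ 2)%N) => //.
  apply: (@leq_trans (p ^ 2)%N); rewrite ?leq_exp2r // leq_exp2l //; nia.
have M_gt0 : (0 < p * #|E|.-1)%N.
  by rewrite muln_gt0 ltnW //=; case: #|E| Q_gt2 => [|[]].
have [zeta prim_zeta] := closed_prim_root_exists (@pchar_num C) M_gt0.
have [z compat] := compatible_root K M_gt0 (prim_expr_order prim_zeta).
have [tau [tau_red tau_gen tau_order]] :=
  teichmuller_exists sigma Q_gt2 prim_zeta compat.
pose lam t := twist tau p h phi t.
pose w := gauss_sum (tau ^+ 1)%g psi.
have w_red : reduces_to zeta z w 0 :=
  gauss_sum_reduces pcharE Q_gt2 prim_zeta compat tau_red psiP.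
have /choice[e eP] i := twisted_exponents p_gt1 h_gt0 card_E tau_gen tau_order
  (n_bnd i) phiB (muB i).
have lam_a t : reduction_unit zeta z (lam t a).
  have [b _ Db] := tau_gen (lam t).
  by apply: (mulchar_runit tau_red a_neq0); exists b.
have prodE t (f : 'I_k -> nat) : (0 < t)%N -> (t < r.+1 + r.+2)%N ->
    (forall i, (f i < #|E|.-1)%N) ->
    (forall i, (expgz (lam t) (n i) * mu i = tau ^+ f i)%g) ->
  exists2 U, reduction_unit zeta z U & c = U * w ^+ (\sum_(i < k) digit_sum p (f i)).
  move=> t_gt0 lt_t lt_f Df.
  have [|u uP] := @choice _ _ (fun i u => reduction_unit zeta z u /\
      gauss_sum (tau ^+ f i)%g psi = u * w ^+ digit_sum p (f i)).
    move=> i; have [u uU Du] := stickelberger pcharE (@pchar_num C) Q_gt2 prim_zeta compat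
      tau_red tau_order psiP (lt_f i).
    by exists u.
  exists ((\prod_i - u i) / lam t a).
    apply: reduction_unitM; last exact/(reduction_unitV compat).
    by apply: reduction_unit_prod => i; apply/reduction_unitN/(uP i).1.
  have identE : (\prod_i - u i) * w ^+ (\sum_(i < k) digit_sum p (f i)) = c * lam t a.
    rewrite -prodrXr -big_split /= -(ident (lam t)); last first.
      by move=> i; apply: (twist_inv_neq p_gt1 h_gt0 card_E tau_order).
    by apply: eq_bigr => i _; rewrite Df (uP i).2 mulNr.
  by rewrite mulrAC identE mulfK // (reduction_unit_neq0 compat).
have [||i|i|U1 U1u c1] := prodE r.+1 (fun i => (e i).1).
- by [].
- by rewrite addnS ltnS leq_addr.
- by case: (eP i) => -[].
- by case: (eP i).
have [||i|i|U2 U2u c2] := prodE r.+2 (fun i => (e i).2).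
- by [].
- by rewrite addSn ltnS leq_addl.
- by case: (eP i) => -[].
- by case: (eP i).
have eqS : (\sum_i digit_sum p (e i).1 = \sum_i digit_sum p (e i).2)%N.
  by apply: (reduction_unit_exp_inj compat U1u U2u w_red); rewrite -c1 -?c2.
apply: (mulIf (_ : (h * p.-1)%:Z != 0)).
  by rewrite eqz_nat -lt0n muln_gt0 h_gt0 -subn1 subn_gt0.
rewrite mul0r big_distrl /= -[RHS](subrr (\sum_i digit_sum p (e i).2)%N%:Z).
rewrite -[in X in _ - X]eqS !(big_morph Posz PoszD (erefl (Posz 0))) -sumrB; apply: eq_bigr => i _.
by case: (eP i).
Qed.

(** * Characters of the algebraic closure and their divisors *)

Section Levels.
Variables (F : finFieldType) (C : fieldType).
Local Notation charGF d := (mulchar (GF F d) C).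
Implicit Types (d e : degree).

Lemma char_class_expgz d (f : charGF d) (n : int) :
  char_class (expgz f n) = expgz (char_class f) n.
Proof.
case: n => n; first exact/esym/char_classX.
by rewrite /expgz -charlim_invE -char_classX.
Qed.

Lemma lift_char_expgz d e (de : (d %| e)%N) (f : charGF d) (n : int) :
  lift_char de (expgz f n) = expgz (lift_char de f) n.
Proof. by case: n => n; rewrite /= ?lift_charV lift_charX. Qed.

(** An equality in the limit holds at some finite level, and finitely many such
    levels have a common multiple. *)
Lemma common_level (I : finType) d (f g : I -> charGF d) :
  (forall i, char_class (f i) = char_class (g i)) ->
  exists e (de : (d %| e)%N), forall i, lift_char de (f i) = lift_char de (g i).
Proof.
move=> fg.
suff [e [de E]] : exists e (de : (d %| e)%N),
    {in enum I, forall i, lift_char de (f i) = lift_char de (g i)}.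
  by exists e, de => i; apply: E; rewrite mem_enum.
elim: (enum I) => [|i s [e [de IHs]]]; first by exists d, (dvdnn d).
have /eqP/char_class_eq[b [db [db' Eb]]] := fg i.
have bg : (b %| degM b e)%N by rewrite dvdn_mulr.
have eg : (e %| degM b e)%N by rewrite dvdn_mull.
exists (degM b e), (dvdn_trans de eg) => j; rewrite inE => /predU1P[->|sj].
  by rewrite -(lift_char_trans db bg) Eb (lift_char_trans db' bg (dvdn_trans de eg)).
by rewrite -!(lift_char_trans de eg) IHs.
Qed.

Lemma coeff_div_pos (chi xi : charlim F C) m : (0 < m)%N ->
  coeff xi (div_pos chi m) = ((xi ^+ m)%g == chi)%:R.
Proof.
move=> m_gt0; rewrite /div_pos fsbig_finite; last exact: finite_char_roots.
rewrite raddf_sum /=; set S := fset_set _.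
have mem_S y : (y \in S) = ((y ^+ m)%g == chi).
  rewrite in_fset_set; last exact: finite_char_roots.
  by apply/idP/eqP=> [/set_mem|Ey]; last apply: mem_set.
rewrite -mem_S; have [xiS|xiS] := boolP (xi \in S).
  rewrite (bigD1_seq xi) //= ?fset_uniq // coeffU mul1r eqxx big1 ?addr0 // => y y_neq.
  by rewrite coeffU (negPf y_neq) mulr0.
rewrite big_seq big1 // => y yS; rewrite coeffU mul1r.
by case: eqP => // Ey; rewrite -Ey yS in xiS.
Qed.

Lemma coeff_divD (chi xi : charlim F C) (n : int) : n != 0 ->
  coeff xi (divD chi n) = sgz n *+ (expgz xi n == chi).
Proof.
case: n => [m|m] n_neq0; rewrite /divD ?coeffN coeff_div_pos //.
- by rewrite gtr0_sgz ?ltz_nat ?lt0n.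
- by rewrite lt0n.
- by rewrite (_ : sgz _ = -1) // mulNrn /= -(inj_eq invg_inj) invgK.
Qed.

End Levels.

Lemma traceD (F : finFieldType) (d : degree) : {morph @trace F d : x y / x + y}.
Proof.
move=> x y; apply: (fmorph_inj (to_closure F)); rewrite rmorphD !iota_trace -big_split.
by apply: eq_bigr => i _; rewrite /= frobD.
Qed.

Theorem theorem3p2p2 (R : realType) (F : finFieldType)
  (psi : F -> R[i])
  (psiD : forall x y, psi (x + y) = psi x * psi y)
  (psi_unit : forall x, psi x != 0)
  (psi_nontrivial : exists x, psi x != 1)
  (k : nat) (chi : 'I_k -> mulchar F R[i]) (n : 'I_k -> int)
  (n_coprime : forall i, coprimez (n i) #|F|)
  (c : R[i]) (c_neq0 : c != 0) (a : F) (a_neq0 : a != 0)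
  (gauss_identity : forall (d : degree) (lambda : mulchar (GF F d) R[i]),
     (forall i, (lambda^-1)%g <> norm_char d (chi i)) ->
     \prod_(i < k)
        (- gauss_sum (expgz lambda (n i) * norm_char d (chi i))%g
                     (psi \o @trace F d))
     = c ^+ d * lambda (in_GF d a)) :
  \sum_(i < k) divD (base_class (chi i)) (n i) = 0.
Proof.
have q_gt1 : (1 < #|F|)%N := finNzRing_gt1 F.
have n_neq0 i : n i != 0.
  apply: contraTneq (n_coprime i) => ->; rewrite /coprimez gcd0z.
  by rewrite neq_ltn [X in _ || X](_ : _ = true) ?orbT.
apply/eqP/freeg_eqP => xi; rewrite coeff0 raddf_sum /=.
rewrite (eq_bigr _ (fun i _ => coeff_divD _ xi (n_neq0 i))).
have [d1 [f Dxi]] := char_classP xi.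
pose good i := expgz xi (n i) == base_class (chi i).
(* Relations that fail are replaced by a trivial one, so that a single level d0
   exhibits exactly those that hold. *)
have [|d0 [d10 good_eq]] := @common_level F R[i] 'I_k d1 (fun i => expgz f (n i))
    (fun i => if good i then norm_char d1 (chi i) else expgz f (n i)).
  move=> i; case: ifP => // /eqP good_i.
  by rewrite char_class_expgz -Dxi good_i (base_classE d1).
have [p [s [p_prime pcharF s_gt0 q_ps]]] := finField_card_pchar F.
pose h := (s * d0)%N; pose r := (\sum_i `|n i|)%N.
have h_gt0 : (0 < h)%N by rewrite muln_gt0 s_gt0 deg_gt0.
have B_gt1 : (1 < p ^ h)%N by rewrite -(expn0 p) ltn_exp2l ?prime_gt1.
(* The number of blocks is T = 2r + 3, so that both t = r + 1 and t = r + 2 leave at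
   least r + 1 blocks on each side of B^t; r only has to satisfy |n_i| <= B^r. *)
pose d := degM d0 (Degree (ltn0Sn (r + r.+2))).
have d0d : (d0 %| d)%N by rewrite dvdn_mulr.
have d1d := dvdn_trans d10 d0d.
pose sigma : {rmorphism GF F d -> alg_closure F} := \val.
have pcharE : p \in [pchar GF F d].
  by rewrite -(fmorph_pchar sigma) (fmorph_pchar (to_closure F)).
have card0 : #|GF F d0| = (p ^ h)%N by rewrite card_GF q_ps -expnM.
have lift_torsion (g : mulchar (GF F d0) R[i]) : (lift_char d0d g ^+ (p ^ h).-1 = 1)%g.
  by rewrite -lift_charX -card0 mulchar_torsion -(expg0 g) lift_charX expg0.
rewrite -[RHS](@gauss_product_relation _ _ _ sigma p h r (psi \o @trace F d) k
  (lift_char d1d f) (fun i => norm_char d (chi i)) n (c ^+ d) (in_GF d a)) //.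
- apply: eq_bigr => i _; congr (_ *+ nat_of_bool _); apply/eqP/eqP=> [good_i|Ed].
    have := good_eq i; rewrite /good good_i eqxx => E0.
    rewrite -(lift_char_trans d10 d0d) -lift_char_expgz -lift_char_expgz E0.
    by rewrite !lift_norm_char.
  by rewrite Dxi -(char_class_lift d1d) -char_class_expgz Ed (base_classE d).
- by rewrite card_GF q_ps -!expnM mulnA.
- split=> [x y|x]; last exact: psi_unit.
  by rewrite /= traceD psiD.
- by rewrite -(lift_char_trans d10 d0d) lift_torsion.
- by move=> i; rewrite -(lift_norm_char d0d) lift_torsion.
- move=> i; rewrite absz_gt0 n_neq0 /=; apply: (@leq_trans r).
    by rewrite /r (bigD1 i) //= leq_addr.
  by apply/ltnW/ltn_expl.
- by rewrite expf_neq0.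
- apply: contra_neq a_neq0 => /(congr1 (@GFval F d)) /= /eqP.
  by rewrite fmorph_eq0 => /eqP.
- by move=> lambda; apply: gauss_identity.
Qed.
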